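(* Under the setting below there exists some $C>0$ such that $$ \mathbb{E}\left(\mathrm{dist}(0,\partial F(x_1^{k+1},x_2^{k+1}))^2\right)\leq C \mathbb{E}(\|u^{k+1}-u^k\|^2)+3\mathbb{E}(\Upsilon_k), $$ where $u^k := (x_1^k,x_2^k,x_1^{k-1},x_2^{k-1},x_1^{k-2},x_2^{k-2})$. In particular, $\mathbb{E}\left(\mathrm{dist}(0,\partial F(x_1^{k+1},x_2^{k+1}))^2 \right) \to 0$ as $k\to\infty$.
   Context: Here $\partial F$ denotes the (general/limiting) subdifferential. Setting: $F\colon \mathbb{R}^{d_1}\times \mathbb{R}^{d_2}\to(-\infty,\infty]$, $F(x_1,x_2)=H(x_1,x_2)+f(x_1)+g(x_2)$ with proper, lower semicontinuous $f,g$ bounded from below, $H$ continuously differentiable, and $\underline F:=\inf F>-\infty$; $H=\frac1n\sum_{i=1}^n h_i$ where each $h_i$ has globally $M$-Lipschitz gradient. For every $x_2$, $\nabla_{x_1}H(\cdot,x_2)$ is globally Lipschitz with constant $L_1(x_2)$, and for every $x_1$, $\nabla_{x_2}H(x_1,\cdot)$ is globally Lipschitz with constant $L_2(x_1)$; there are $\lambda_i^-,\lambda_i^+>0$ with $\lambda_1^-\le L_1(x_2^k)\le\lambda_1^+$, $\lambda_2^-\le L_2(x_1^k)\le\lambda_2^+$ for all $k$. $(x_1^k,x_2^k)_k$ is generated by iSPALM: with $\mathrm{prox}_\tau^f(x):=\operatorname{argmin}_y\{\tfrac\tau2\|x-y\|^2+f(y)\}$ and $(x_1^{-1},x_2^{-1})=(x_1^0,x_2^0)$,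 for $k=0,1,\dots$: $y_1^k=x_1^k+\alpha_1^k(x_1^k-x_1^{k-1})$, $z_1^k=x_1^k+\beta_1^k(x_1^k-x_1^{k-1})$, $x_1^{k+1}\in\mathrm{prox}_{\tau_1^k}^f(y_1^k-\tfrac1{\tau_1^k}\tilde\nabla_{x_1}H(z_1^k,x_2^k))$; $y_2^k=x_2^k+\alpha_2^k(x_2^k-x_2^{k-1})$, $z_2^k=x_2^k+\beta_2^k(x_2^k-x_2^{k-1})$, $x_2^{k+1}\in\mathrm{prox}_{\tau_2^k}^g(y_2^k-\tfrac1{\tau_2^k}\tilde\nabla_{x_2}H(x_1^{k+1},z_2^k))$. $\tilde\nabla$ is an inertial variance-reduced estimator with constants $V_1,V_\Upsilon\ge0$, $\rho\in(0,1]$: for any sequence with $x^{-1}=x^0$ and $0\le\beta_i^k<\bar\beta_i$ there are random variables $\Upsilon_k\ge0$ with $\mathbb{E}(\Upsilon_1)<\infty$ such that, with $\mathbb{E}_k$ the conditional expectation given the first $k$ iterates, (i) $\mathbb{E}_k(\|\tilde\nabla_{x_1}H(z_1^k,x_2^k)-\nabla_{x_1}H(z_1^k,x_2^k)\|^2+\|\tilde\nabla_{x_2}H(x_1^{k+1},z_2^k)-\nabla_{x_2}H(x_1^{k+1},z_2^k)\|^2)\le\Upsilon_k+V_1(\mathbb{E}_k\|x^{k+1}-x^k\|^2+\|x^k-x^{k-1}\|^2+\|x^{k-1}-x^{k-2}\|^2)$; (ii) $\mathbb{E}_k(\Upsilon_{k+1})\le(1-\rho)\Upsilon_k+V_\Upsilon(\mathbb{E}_k\|x^{k+1}-x^k\|^2+\|x^k-x^{k-1}\|^2+\|x^{k-1}-x^{k-2}\|^2)$;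 (iii) $\mathbb{E}\|x^k-x^{k-1}\|^2\to0$ implies $\mathbb{E}(\Upsilon_k)\to0$. Parameter conditions: there exist $\epsilon,\varepsilon>0$ such that for all $k$ and $i=1,2$: $0\le\alpha_i^k\le\bar\alpha_i$ with $0<\bar\alpha_i<\tfrac{1-\epsilon}2$, $0\le\beta_i^k\le\bar\beta_i$ with $0<\bar\beta_i\le1$; $\tau_1^k=\frac{(1+\epsilon)\delta_1+M+L_1(x_2^k)+S}{1-\alpha_1^k}$, $\tau_2^k=\frac{(1+\epsilon)\delta_2+M+L_2(x_1^{k+1})+S}{1-\alpha_2^k}$, with $S:=4\tfrac{\rho V_1+V_\Upsilon}{\rho M}+\varepsilon$ and $\delta_i:=\frac{(M+\lambda_i^+)\bar\alpha_i+2\lambda_i^+\bar\beta_i^2+S}{1-2\bar\alpha_i-\epsilon}$. *)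

(* Defs.v *)
From HB Require Import structures.
From mathcomp Require Import all_boot all_order all_algebra.
From mathcomp Require Import all_classical all_reals all_analysis.
Set Implicit Arguments. Unset Strict Implicit. Unset Printing Implicit Defensive.
Import Order.TTheory GRing.Theory Num.Theory.
Import numFieldNormedType.Exports.
Local Open Scope classical_set_scope.
Local Open Scope ring_scope.

Section Defs.
Variable R : realType.

Definition dotv (d : nat) (u v : 'rV[R]_d) : R := \sum_(i < d) u 0 i * v 0 i.
Definition enorm (d : nat) (v : 'rV[R]_d) : R := Num.sqrt (\sum_(i < d) v 0 i ^+ 2).

Definition pnorm2 (d1 d2 : nat) (v1 : 'rV[R]_d1) (v2 : 'rV[R]_d2) : R :=
  enorm v1 ^+ 2 + enorm v2 ^+ 2.
Definition pnorm (d1 d2 : nat) (v1 : 'rV[R]_d1) (v2 : 'rV[R]_d2) : R :=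
  Num.sqrt (pnorm2 v1 v2).

Variables d1 d2 : nat.

Definition is_gradient (h : 'rV[R]_d1 -> 'rV[R]_d2 -> R)
  (D1 : 'rV[R]_d1 -> 'rV[R]_d2 -> 'rV[R]_d1)
  (D2 : 'rV[R]_d1 -> 'rV[R]_d2 -> 'rV[R]_d2) : Prop :=
  forall a b (e : R), 0 < e -> exists2 dl : R, 0 < dl &
    forall y1 y2, pnorm (y1 - a) (y2 - b) < dl ->
      `| h y1 y2 - h a b - dotv (D1 a b) (y1 - a) - dotv (D2 a b) (y2 - b) |
        <= e * pnorm (y1 - a) (y2 - b).

Definition lipschitz_gradient (M : R)
  (D1 : 'rV[R]_d1 -> 'rV[R]_d2 -> 'rV[R]_d1)
  (D2 : 'rV[R]_d1 -> 'rV[R]_d2 -> 'rV[R]_d2) : Prop :=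
  forall a b a' b', pnorm (D1 a b - D1 a' b') (D2 a b - D2 a' b')
                    <= M * pnorm (a - a') (b - b').

Definition frechet_subdiff (F : 'rV[R]_d1 -> 'rV[R]_d2 -> \bar R)
  (a : 'rV[R]_d1) (b : 'rV[R]_d2) : set ('rV[R]_d1 * 'rV[R]_d2) :=
  [set v | F a b \is a fin_num /\
    forall e : R, 0 < e -> exists2 dl : R, 0 < dl &
      forall y1 y2, pnorm (y1 - a) (y2 - b) < dl ->
        ((fine (F a b) + dotv v.1 (y1 - a) + dotv v.2 (y2 - b)
           - e * pnorm (y1 - a) (y2 - b))%:E <= F y1 y2)%E].

Definition limiting_subdiff (F : 'rV[R]_d1 -> 'rV[R]_d2 -> \bar R)
  (a : 'rV[R]_d1) (b : 'rV[R]_d2) : set ('rV[R]_d1 * 'rV[R]_d2) :=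
  [set v | F a b \is a fin_num /\
    exists (s1 : nat -> 'rV[R]_d1) (s2 : nat -> 'rV[R]_d2)
           (w : nat -> 'rV[R]_d1 * 'rV[R]_d2),
      (forall j, frechet_subdiff F (s1 j) (s2 j) (w j)) /\
      (forall e : R, 0 < e -> exists N, forall j, (N <= j)%N ->
         [/\ pnorm (s1 j - a) (s2 j - b) < e,
             `| fine (F (s1 j) (s2 j)) - fine (F a b) | < e &
             pnorm ((w j).1 - v.1) ((w j).2 - v.2) < e])].

(* dist(0, S) in \bar R (= +oo if S is empty) *)
Definition dist0 (S : set ('rV[R]_d1 * 'rV[R]_d2)) : \bar R :=
  ereal_inf [set (pnorm v.1 v.2)%:E | v in S].

End Defs.

Definition proper_fun (R : realType) (d : nat) (f : 'rV[R]_d -> \bar R) : Prop :=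
  (forall x, f x != -oo%E) /\ exists x, f x \is a fin_num.
Definition lsc (R : realType) (d : nat) (f : 'rV[R]_d -> \bar R) : Prop :=
  forall x (a : R), (a%:E < f x)%E -> exists2 dl : R, 0 < dl &
    forall y, enorm (y - x) < dl -> (a%:E < f y)%E.
Definition bounded_below (R : realType) (d : nat) (f : 'rV[R]_d -> \bar R) : Prop :=
  exists m : R, forall x, (m%:E <= f x)%E.

Definition prox (R : realType) (d : nat) (tau : R) (f : 'rV[R]_d -> \bar R)
  (x : 'rV[R]_d) : set 'rV[R]_d :=
  [set y | forall z, ((tau / 2 * enorm (x - y) ^+ 2)%:E + f y
                      <= (tau / 2 * enorm (x - z) ^+ 2)%:E + f z)%E].

Section Prob.
Context (R : realType) (d : measure_display) (Omega : measurableType d)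
        (P : probability Omega R).

Definition Ex (X : Omega -> \bar R) : \bar R := (\int[P]_w X w)%E.

Definition gen_sigma (d1 d2 : nat) (x1 : nat -> Omega -> 'rV[R]_d1)
  (x2 : nat -> Omega -> 'rV[R]_d2) (k : nat) : set (set Omega) :=
  <<s [set A | exists j, (j <= k)%N /\
        ((exists (i : 'I_d1) (B : set R), measurable B /\
            A = (fun w => x1 j w 0 i) @^-1` B) \/
         (exists (i : 'I_d2) (B : set R), measurable B /\
            A = (fun w => x2 j w 0 i) @^-1` B))] >>.

Definition is_cond_exp (G : set (set Omega)) (X Z : Omega -> R) : Prop :=
  (forall B : set R, measurable B -> G (Z @^-1` B)) /\
  P.-integrable setT (fun w => (Z w)%:E) /\
  forall A, G A -> (\int[P]_(w in A) (X w)%:E = \int[P]_(w in A) (Z w)%:E)%E.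
End Prob.

(* Main.v *)
Require Import Defs.
From HB Require Import structures.
From mathcomp Require Import all_boot all_order all_algebra.
From mathcomp Require Import all_classical all_reals all_analysis.
From mathcomp Require Import measurable_realfun ring lra.
Set Implicit Arguments.
Unset Strict Implicit.
Import Order.TTheory GRing.Theory Num.Theory.
Import numFieldNormedType.Exports.
Local Open Scope classical_set_scope.
Local Open Scope ring_scope.

(** The optimality condition of the proximal steps puts the vector with blocks
    [grad_i H(x^{k+1}) + tau_i (y_i - x_i^{k+1}) - G_i] into the subdifferential
    of [F] at [x^{k+1}].  By Lipschitz continuity its squared norm is at most
    [C0 |u^{k+1} - u^k|^2 + 3 err_k], where [err_k] is the squared error of the
    estimator; taking expectations gives the bound.

    For the convergence, comparing [x^{k+1}] with [x^k] in the proximal steps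
    yields, path by path, a descent of
    [Phi_k = F(x^k) + sum_i delta_i/2 |x_i^k - x_i^{k-1}|^2]:
    [Phi_{k+1} <= Phi_k + err_k / M - S/2 (|x^{k+1} - x^k|^2 + |x^k - x^{k-1}|^2)].
    The sum starts at [k = 1], because [F(x^0)] may be infinite; [F(x^1)] is
    bounded by comparing the first proximal step with a fixed point of the
    domain.  In expectation the errors are absorbed by the [S] term, so the
    expected squared increments are summable and tend to [0], and so does
    [E Ups_k]. *)

(** * Inner products *)

Section InnerProduct.
Context {R : realType} {d : nat}.
Implicit Types u v w : 'rV[R]_d.

Lemma dotvC u v : dotv u v = dotv v u.
Proof. by apply: eq_bigr => i _; rewrite mulrC. Qed.

Lemma dotvDl u v w : dotv (u + v) w = dotv u w + dotv v w.
Proof. by rewrite -big_split; apply: eq_bigr => i _; rewrite mxE mulrDl. Qed.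

Lemma dotvZl a u v : dotv (a *: u) v = a * dotv u v.
Proof. by rewrite /dotv mulr_sumr; apply: eq_bigr => i _; rewrite mxE mulrA. Qed.

Lemma dotvNl u v : dotv (- u) v = - dotv u v.
Proof. by rewrite -scaleN1r dotvZl mulN1r. Qed.

Lemma dotvDr u v w : dotv w (u + v) = dotv w u + dotv w v.
Proof. by rewrite dotvC dotvDl !(dotvC w). Qed.

Lemma dotvZr a u v : dotv v (a *: u) = a * dotv v u.
Proof. by rewrite dotvC dotvZl (dotvC v). Qed.

Lemma dotvNr u v : dotv v (- u) = - dotv v u.
Proof. by rewrite dotvC dotvNl (dotvC v). Qed.

Lemma dot0v v : dotv 0 v = 0.
Proof. by rewrite -(scale0r v) dotvZl mul0r. Qed.

Definition dotvE :=
  (dotvDl, dotvDr, dotvNl, dotvNr, dotvZl, dotvZr).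

Lemma dotvv_ge0 u : 0 <= dotv u u.
Proof. by apply: sumr_ge0 => i _; rewrite -expr2 sqr_ge0. Qed.

Lemma enorm2E u : enorm u ^+ 2 = dotv u u.
Proof.
rewrite sqr_sqrtr; first by apply: eq_bigr => i _; rewrite expr2.
by apply: sumr_ge0 => i _; exact: sqr_ge0.
Qed.

Lemma enorm_ge0 u : 0 <= enorm u.
Proof. exact: sqrtr_ge0. Qed.

Lemma enorm_le_sq a u v : 0 <= a -> enorm u <= a * enorm v ->
  dotv u u <= a ^+ 2 * dotv v v.
Proof.
move=> a0 uv; rewrite -!enorm2E -exprMn.
by rewrite lerXn2r ?nnegrE ?mulr_ge0 ?enorm_ge0.
Qed.

(** The right side minus the left is a square, [a / 4] times that of [2 / a u - v]. The weights are
    placed so that [a = M] leaves [M^-1] on the error term. *)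
Lemma young a u v : 0 < a ->
  dotv u v <= a^-1 * dotv u u + a / 4 * dotv v v.
Proof.
move=> a0; rewrite -subr_ge0.
have -> : a^-1 * dotv u u + a / 4 * dotv v v - dotv u v
    = a / 4 * dotv ((2 * a^-1) *: u - v) ((2 * a^-1) *: u - v).
  by rewrite !dotvE (dotvC v u); field; rewrite gt_eqF.
by rewrite mulr_ge0 ?dotvv_ge0 ?divr_ge0 ?ltW.
Qed.

(** Takes the place of Cauchy-Schwarz: expand the nonnegative square of [u - a *: v]. *)
Lemma dotv_le a u v : 0 < a -> dotv u u <= a ^+ 2 * dotv v v ->
  dotv u v <= a * dotv v v.
Proof.
move=> a0 uv; rewrite -subr_ge0.
have -> : a * dotv v v - dotv u v
    = (2 * a)^-1 * (dotv (u - a *: v) (u - a *: v)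
                    + (a ^+ 2 * dotv v v - dotv u u)).
  by rewrite !dotvE (dotvC v u); field; rewrite gt_eqF.
apply: mulr_ge0; first by rewrite invr_ge0 mulr_ge0// ltW.
by rewrite addr_ge0 ?dotvv_ge0// subr_ge0.
Qed.

Lemma dotv_sqD u v : dotv (u + v) (u + v) <= 2 * (dotv u u + dotv v v).
Proof.
by have := dotvv_ge0 (u - v); rewrite !dotvE (dotvC v u); lra.
Qed.

Lemma dotv_sqB u v : dotv (u - v) (u - v) <= 2 * (dotv u u + dotv v v).
Proof. by have := dotv_sqD u (- v); rewrite !dotvE; lra. Qed.

Lemma dotv_sqD3 u v w : dotv (u + v + w) (u + v + w)
  <= 3 * (dotv u u + dotv v v + dotv w w).
Proof.
have := dotvv_ge0 (u - v); have := dotvv_ge0 (u - w).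
have := dotvv_ge0 (v - w).
by rewrite !dotvE (dotvC v u) (dotvC w u) (dotvC w v); lra.
Qed.

(** The variance of the [F i] about their mean [m] is nonnegative. *)
Lemma dotv_sqr_mean n (F : 'I_n -> 'rV[R]_d) :
  dotv (n%:R^-1 *: \sum_i F i) (n%:R^-1 *: \sum_i F i)
  <= n%:R^-1 * \sum_i dotv (F i) (F i).
Proof.
case: n F => [|n] F; first by rewrite !big_ord0 scaler0 mulr0 dot0v.
set m := _ *: _.
have m_sum : \sum_i F i = n.+1%:R *: m.
  by rewrite scalerA mulfV ?scale1r// pnatr_eq0.
clearbody m; have : 0 <= \sum_i dotv (F i - m) (F i - m).
  by apply: sumr_ge0 => i _; exact: dotvv_ge0.
under eq_bigr => i _ do rewrite !dotvE (dotvC m).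
rewrite !big_split /= !sumrN.
have -> : \sum_i dotv (F i) m = n.+1%:R * dotv m m.
  rewrite -dotvZl -m_sum.
  elim/big_rec2 : _ => [|i x y _ ->]; last by rewrite dotvDl.
  by rewrite dot0v.
rewrite sumr_const card_ord -mulr_natl => h.
rewrite mulrC ler_pdivlMr ?ltr0n//; move: h; lra.
Qed.
End InnerProduct.

Section Pnorm.
Context {R : realType} {d1 d2 : nat}.
Implicit Types (u : 'rV[R]_d1) (v : 'rV[R]_d2).

Lemma pnorm2E u v : pnorm2 u v = dotv u u + dotv v v.
Proof. by rewrite /pnorm2 !enorm2E. Qed.

Lemma pnorm2_ge0 u v : 0 <= pnorm2 u v.
Proof. by rewrite pnorm2E addr_ge0 ?dotvv_ge0. Qed.

Lemma pnorm_ge0 u v : 0 <= pnorm u v.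
Proof. exact: sqrtr_ge0. Qed.

Lemma pnorm_sq u v : pnorm u v ^+ 2 = pnorm2 u v.
Proof. by rewrite sqr_sqrtr// pnorm2_ge0. Qed.

Lemma pnormZ a u v : pnorm (a *: u) (a *: v) = `|a| * pnorm u v.
Proof.
rewrite /pnorm -sqrtr_sqr -sqrtrM ?sqr_ge0// !pnorm2E !dotvE.
by congr Num.sqrt; ring.
Qed.

Lemma pnorm0 : pnorm (0 : 'rV[R]_d1) (0 : 'rV[R]_d2) = 0.
Proof. by have := pnormZ 0 0 0; rewrite !scaler0 normr0 mul0r. Qed.
End Pnorm.

(** * Gradients and descent *)

Section Gradient.
Context {R : realType} {d1 d2 : nat}.
Local Notation V1 := 'rV[R]_d1.
Local Notation V2 := 'rV[R]_d2.
Implicit Types (h : V1 -> V2 -> R).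

Lemma is_gradient0 :
  @is_gradient R d1 d2 (fun _ _ => 0) (fun _ _ => 0) (fun _ _ => 0).
Proof.
move=> a b e e0; exists 1 => // y1 y2 _; rewrite !dot0v.
by rewrite !subr0 normr0 mulr_ge0 ?pnorm_ge0 ?ltW.
Qed.

Lemma is_gradientD h D1 D2 h' D1' D2' :
  is_gradient h D1 D2 -> is_gradient h' D1' D2' ->
  is_gradient (fun u v => h u v + h' u v) (fun u v => D1 u v + D1' u v)
    (fun u v => D2 u v + D2' u v).
Proof.
move=> g g' a b e e0; have e2 : 0 < e / 2 by rewrite divr_gt0.
have [dl dl0 H] := g a b _ e2; have [dl' dl'0 H'] := g' a b _ e2.
exists (Num.min dl dl'); first by rewrite lt_min dl0.
move=> y1 y2; rewrite lt_min => /andP[/H {}H /H' {}H'].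
have -> : e * pnorm (y1 - a) (y2 - b)
    = e / 2 * pnorm (y1 - a) (y2 - b) + e / 2 * pnorm (y1 - a) (y2 - b).
  by field.
apply: le_trans (lerD H H'); rewrite !dotvDl.
apply: le_trans (ler_normD _ _).
by rewrite le_eqVlt; apply/orP; left; apply/eqP; congr (Num.norm _); ring.
Qed.

Lemma is_gradientZ c h (D1 : V1 -> V2 -> V1) (D2 : V1 -> V2 -> V2) :
  is_gradient h D1 D2 ->
  is_gradient (fun u v => c * h u v) (fun u v => c *: D1 u v)
    (fun u v => c *: D2 u v).
Proof.
(* The [+ 1] keeps the divisor positive even when [c = 0]. *)
move=> g a b e e0; have c0 : 0 < `|c| + 1 by rewrite ltr_wpDl.
have [|dl dl0 H] := g a b (e / (`|c| + 1)); first by rewrite divr_gt0.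
exists dl => // y1 y2 /H {}H; rewrite !dotvZl -!mulrBr normrM.
apply: le_trans (ler_wpM2l (normr_ge0 _) H) _; rewrite mulrA.
apply: ler_wpM2r; first exact: pnorm_ge0.
by rewrite mulrCA ger_pMr// ler_pdivrMr// mul1r lerDl.
Qed.

Lemma is_gradient_sum n (h : 'I_n -> V1 -> V2 -> R)
    (D1 : 'I_n -> V1 -> V2 -> V1) (D2 : 'I_n -> V1 -> V2 -> V2) :
  (forall i, is_gradient (h i) (D1 i) (D2 i)) ->
  is_gradient (fun u v => \sum_i h i u v) (fun u v => \sum_i D1 i u v)
    (fun u v => \sum_i D2 i u v).
Proof.
elim: n h D1 D2 => [|n IH] h D1 D2 g.
  have := is_gradient0; congr is_gradient;
    by apply/funext => u; apply/funext => v; rewrite big_ord0.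
have := is_gradientD (g ord0) (IH _ _ _ (fun i => g (lift ord0 i))).
by congr is_gradient; apply/funext => u; apply/funext => v;
  rewrite big_ord_recl.
Qed.

Lemma lipschitz_pnorm2 M (D1 : V1 -> V2 -> V1) (D2 : V1 -> V2 -> V2) :
  0 <= M -> lipschitz_gradient M D1 D2 ->
  forall a b a' b', pnorm2 (D1 a b - D1 a' b') (D2 a b - D2 a' b')
    <= M ^+ 2 * pnorm2 (a - a') (b - b').
Proof.
move=> M0 L a b a' b'; rewrite -!pnorm_sq -exprMn.
by rewrite lerXn2r ?nnegrE ?mulr_ge0 ?pnorm_ge0.
Qed.

(** By convexity of the square, averaging the gradients preserves the constant [M]. *)
Lemma lipschitz_gradient_mean n M (D1 : 'I_n -> V1 -> V2 -> V1)
    (D2 : 'I_n -> V1 -> V2 -> V2) : (0 < n)%N -> 0 <= M ->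
  (forall i, lipschitz_gradient M (D1 i) (D2 i)) ->
  forall a b a' b',
  pnorm2 (n%:R^-1 *: (\sum_i D1 i a b) - n%:R^-1 *: (\sum_i D1 i a' b'))
         (n%:R^-1 *: (\sum_i D2 i a b) - n%:R^-1 *: (\sum_i D2 i a' b'))
    <= M ^+ 2 * pnorm2 (a - a') (b - b').
Proof.
move=> n0 M0 L a b a' b'; rewrite -!scalerBr -!sumrB pnorm2E.
apply: le_trans (lerD (dotv_sqr_mean _) (dotv_sqr_mean _)) _.
rewrite -mulrDr -big_split /= mulrC ler_pdivrMr ?ltr0n//.
have -> : M ^+ 2 * pnorm2 (a - a') (b - b') * n%:R
    = \sum_(i < n) M ^+ 2 * pnorm2 (a - a') (b - b').
  by rewrite sumr_const card_ord mulr_natr.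
by apply: ler_sum => i _; rewrite -pnorm2E; exact: lipschitz_pnorm2.
Qed.

(** Chain rule along a line: the difference quotient minus [l] is [s^-1] times the first-order
    remainder of [h]. *)
Lemma is_derive_segment h (D1 : V1 -> V2 -> V1) (D2 : V1 -> V2 -> V2)
    a b u v (t : R) : is_gradient h D1 D2 ->
  is_derive t (1 : R) (fun s : R => h (a + s *: u) (b + s *: v))
   (dotv (D1 (a + t *: u) (b + t *: v)) u +
    dotv (D2 (a + t *: u) (b + t *: v)) v).
Proof.
move=> g; set phi := fun s : R => _; set l := _ + _.
have N0 : 0 < pnorm u v + 1 by rewrite ltr_wpDl ?pnorm_ge0.
suff H : (fun s => s^-1 *: ((phi \o shift t) (s *: 1) - phi t)) @ 0^' --> l.
  by apply: DeriveDef; [apply/cvg_ex; exists l|exact/cvg_lim].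
apply/cvgrPdist_le => e e0.
have [|dl dl0 {}g] := g (a + t *: u) (b + t *: v) (e / (pnorm u v + 1)).
  by rewrite divr_gt0.
near=> s.
have s0 : s != 0 by near: s; exact: nbhs_dnbhs_neq.
have sdl : `|s| < dl / (pnorm u v + 1).
  by near: s; apply: dnbhs0_lt; rewrite divr_gt0.
have Ea : a + (s + t) *: u - (a + t *: u) = s *: u.
  by rewrite scalerDl opprD addrACA subrr add0r addrK.
have Eb : b + (s + t) *: v - (b + t *: v) = s *: v.
  by rewrite scalerDl opprD addrACA subrr add0r addrK.
have /g : pnorm (a + (s + t) *: u - (a + t *: u))
    (b + (s + t) *: v - (b + t *: v)) < dl.
  rewrite Ea Eb pnormZ; move: sdl; rewrite ltr_pdivlMr//; apply: le_lt_trans.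
  by rewrite ler_wpM2l// lerDl.
rewrite Ea Eb pnormZ !dotvZr => H.
rewrite /= /phi /shift /= [s *: 1]mulr1.
have -> : l - s^-1 *: (h (a + (s + t) *: u) (b + (s + t) *: v)
    - h (a + t *: u) (b + t *: v)) =
  - (s^-1 * (h (a + (s + t) *: u) (b + (s + t) *: v)
    - h (a + t *: u) (b + t *: v) - s * dotv (D1 (a + t *: u) (b + t *: v)) u
    - s * dotv (D2 (a + t *: u) (b + t *: v)) v)).
  by rewrite /GRing.scale /= /l; field.
rewrite normrN normrM normfV.
apply: le_trans (ler_wpM2l _ H) _; first by rewrite invr_ge0.
rewrite mulrCA mulKf ?normr_eq0// -mulrA ger_pMr//.
by rewrite mulrC ler_pdivrMr// mul1r lerDl.
Unshelve. all: by end_near. Qed.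

(** Instead of integrating the gradient, apply the mean value theorem to [psi], which is [h] on the
    segment minus the quadratic whose derivative is [c + K * t]. Then [dpsi <= 0] on (0,1), so
    [psi 1 <= psi 0]. *)
Lemma gradient_segment_le h (D1 : V1 -> V2 -> V1) (D2 : V1 -> V2 -> V2)
    a b u v K : is_gradient h D1 D2 ->
  (forall t, 0 < t < 1 ->
    dotv (D1 (a + t *: u) (b + t *: v) - D1 a b) u +
    dotv (D2 (a + t *: u) (b + t *: v) - D2 a b) v <= K * t) ->
  h (a + u) (b + v) <= h a b + dotv (D1 a b) u + dotv (D2 a b) v + K / 2.
Proof.
move=> g HK; set c := dotv (D1 a b) u + dotv (D2 a b) v.
pose psi s := h (a + s *: u) (b + s *: v) - (s * c + K / 2 * s ^+ 2).
pose dpsi t := dotv (D1 (a + t *: u) (b + t *: v)) u +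
    dotv (D2 (a + t *: u) (b + t *: v)) v - (c + K * t).
have psi' (t : R) : is_derive t (1 : R) psi (dpsi t).
  apply: is_deriveB; first exact: is_derive_segment.
  rewrite (_ : (fun s => _) = c \*: (id : R -> R) + (K / 2) \*: (id : R -> R) ^+ 2).
    by apply: is_derive_eq; rewrite /GRing.scale /=; field.
  by apply/funext => s; rewrite [s * c]mulrC.
have [||t t01 E] := @MVT R psi dpsi 0 1.
- by [].
- apply: derivable_within_continuous => x _; exact: ex_derive.
have {}t01 : 0 < t < 1 by move: t01; rewrite in_itv.
move: E; rewrite subr0 mulr1 /psi /dpsi !scale1r !scale0r !addr0.
have := HK _ t01; rewrite !dotvE /c; lra.
Qed.
End Gradient.

(** * Proximal steps and subgradients *)

Section Prox.
Context {R : realType} {d : nat}.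
Variable f : 'rV[R]_d -> \bar R.
Hypothesis f_proper : proper_fun f.

Lemma prox_fin_num tau x y : y \in prox tau f x -> f y \is a fin_num.
Proof.
move=> /set_mem yP; have [fN [z fz]] := f_proper.
move: (yP z) (fN y); rewrite -(fineK fz).
by case: (f y).
Qed.

(** Expanding the squares centred at [Y - tau^-1 *: G], the terms in [G] and [Y] alone are the same
    on both sides and cancel. *)
Lemma prox_le tau Y G y z : 0 < tau ->
  y \in prox tau f (Y - tau^-1 *: G) -> f z \is a fin_num ->
  fine (f y) + dotv G (y - z) + tau / 2 * dotv (y - Y) (y - Y)
  <= fine (f z) + tau / 2 * dotv (z - Y) (z - Y).
Proof.
move=> tau0 yP fz; have fy := prox_fin_num yP; have := set_mem yP z.
rewrite -(fineK fy) -(fineK fz) -!EFinD lee_fin !enorm2E.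
have E w : tau / 2 * dotv (Y - tau^-1 *: G - w) (Y - tau^-1 *: G - w) =
    tau / 2 * dotv (w - Y) (w - Y) + dotv G w - dotv G Y + tau^-1 / 2 * dotv G G.
  by rewrite !dotvE (dotvC w Y) (dotvC w G) (dotvC Y G); field; rewrite gt_eqF.
by rewrite !E !dotvE; lra.
Qed.

(** Re-centring [prox_le] at [y] makes [tau *: (Y - y) - G] a proximal subgradient, with a quadratic
    defect; the inequality is trivial where [f z] is infinite. *)
Lemma prox_subgradient tau Y G y z : 0 < tau ->
  y \in prox tau f (Y - tau^-1 *: G) ->
  ((fine (f y) + dotv (tau *: (Y - y) - G) (z - y)
    - tau / 2 * dotv (z - y) (z - y))%:E <= f z)%E.
Proof.
move=> tau0 yP; have [fN _] := f_proper; move: (fN z).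
case fzE : (f z) => [r| |] // _; last exact: leey.
have fz : f z \is a fin_num by rewrite fzE.
have := prox_le tau0 yP fz; rewrite fzE lee_fin /= !dotvE.
rewrite (dotvC y Y) (dotvC y z) (dotvC z Y) (dotvC z y); lra.
Qed.
End Prox.

Lemma frechet_subset_limiting {R : realType} {d1 d2 : nat}
    (F : 'rV[R]_d1 -> 'rV[R]_d2 -> \bar R) a b :
  frechet_subdiff F a b `<=` limiting_subdiff F a b.
Proof.
move=> v Fv; split; first by case: Fv.
exists (fun=> a), (fun=> b), (fun=> v); split=> // e e0; exists 0%N => j _.
by rewrite !subrr pnorm0 normr0; split.
Qed.

Lemma dist0_sq_le {R : realType} {d1 d2 : nat}
    (A : set ('rV[R]_d1 * 'rV[R]_d2)) v : A v ->
  (dist0 A * dist0 A <= (pnorm2 v.1 v.2)%:E)%E.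
Proof.
move=> Av; have dist_ge0 : (0 <= dist0 A)%E.
  by apply/le_ereal_inf_tmp => _ [w _ <-]; rewrite lee_fin pnorm_ge0.
have dist_le : (dist0 A <= (pnorm v.1 v.2)%:E)%E.
  by apply: ereal_inf_lbound; exists v.
by rewrite -pnorm_sq expr2 EFinM; exact: lee_pmul.
Qed.

Lemma dist0_sq_ge0 {R : realType} {d1 d2 : nat}
    (A : set ('rV[R]_d1 * 'rV[R]_d2)) : (0 <= dist0 A * dist0 A)%E.
Proof.
by apply: mule_ge0; apply/le_ereal_inf_tmp => _ [w _ <-]; rewrite lee_fin pnorm_ge0.
Qed.

(** * Subgradients of the composite function and descent inequalities for its smooth part *)

Section Composite.
Context {R : realType} {d1 d2 : nat}.
Variables (H : 'rV[R]_d1 -> 'rV[R]_d2 -> R)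
  (gH1 : 'rV[R]_d1 -> 'rV[R]_d2 -> 'rV[R]_d1)
  (gH2 : 'rV[R]_d1 -> 'rV[R]_d2 -> 'rV[R]_d2)
  (f : 'rV[R]_d1 -> \bar R) (g : 'rV[R]_d2 -> \bar R).
Hypothesis gH : is_gradient H gH1 gH2.
Let F u v := ((H u v)%:E + f u + g v)%E.

(** Half of [e] pays for the first-order remainder of [H]. The other half pays for the two quadratic
    defects, which are below [e / 2 * n] once [n] times [|s| + |t| + 1] is below [e / 2]. *)
Lemma frechet_composite a b p q s t : f a \is a fin_num -> g b \is a fin_num ->
  (forall z, ((fine (f a) + dotv p (z - a) - s * dotv (z - a) (z - a))%:E <= f z)%E) ->
  (forall z, ((fine (g b) + dotv q (z - b) - t * dotv (z - b) (z - b))%:E <= g z)%E) ->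
  frechet_subdiff F a b (gH1 a b + p, gH2 a b + q).
Proof.
move=> fa gb fp gq.
split=> [|e e0]; first by rewrite /F -(fineK fa) -(fineK gb).
have e2 : 0 < e / 2 by rewrite divr_gt0.
have [dl dl0 gHab] := gH a b e2.
pose T := `|s| + `|t| + 1.
have T0 : 0 < T by rewrite ltr_wpDl// addr_ge0.
exists (Num.min dl (e / 2 / T)); first by rewrite lt_min dl0 divr_gt0.
move=> y1 y2; rewrite lt_min => /andP[/gHab {}gHab].
rewrite ltr_pdivlMr// => small.
rewrite /F -(fineK fa) -(fineK gb) /=.
have := leeD (fp y1) (gq y2); rewrite -EFinD => fg.
rewrite -addeA; apply: le_trans (leeD2l _ fg); rewrite -EFinD lee_fin.
set n := pnorm _ _ in gHab small *.
have n0 : 0 <= n by exact: pnorm_ge0.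
have sq : s * dotv (y1 - a) (y1 - a) + t * dotv (y2 - b) (y2 - b) <= e / 2 * n.
  have : n * T * n <= e / 2 * n by rewrite ler_wpM2r// ltW.
  apply: le_trans; rewrite mulrAC -expr2 pnorm_sq pnorm2E.
  have := dotvv_ge0 (y1 - a); have := dotvv_ge0 (y2 - b).
  move: (dotv (y1 - a) _) (dotv (y2 - b) _) => A B B0 A0.
  have := ler_wpM2r A0 (ler_norm s); have := ler_wpM2r B0 (ler_norm t).
  have := mulr_ge0 (normr_ge0 s) B0; have := mulr_ge0 (normr_ge0 t) A0.
  by rewrite /T; lra.
move: gHab; rewrite ler_norml => /andP[+ _].
rewrite (dotvDl (gH1 a b)) (dotvDl (gH2 a b)) /=; move: sq; lra.
Qed.

Lemma descent_fst a b u L : 0 < L ->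
  (forall a', enorm (gH1 a' b - gH1 a b) <= L * enorm (a' - a)) ->
  H (a + u) b <= H a b + dotv (gH1 a b) u + L / 2 * dotv u u.
Proof.
move=> L0 lip; have := @gradient_segment_le _ _ _ _ _ _ a b u 0 (L * dotv u u) gH.
rewrite addr0 [dotv _ 0]dotvC dot0v addr0 mulrAC; apply=> t /andP[t0 _].
rewrite scaler0 addr0 [dotv _ 0]dotvC dot0v addr0 mulrAC.
apply: dotv_le; first exact: mulr_gt0.
have := enorm_le_sq (ltW L0) (lip (a + t *: u)).
rewrite [a + t *: u - a]addrAC subrr add0r !dotvE; lra.
Qed.

Lemma descent_snd a b v L : 0 < L ->
  (forall b', enorm (gH2 a b' - gH2 a b) <= L * enorm (b' - b)) ->
  H a (b + v) <= H a b + dotv (gH2 a b) v + L / 2 * dotv v v.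
Proof.
move=> L0 lip; have := @gradient_segment_le _ _ _ _ _ _ a b 0 v (L * dotv v v) gH.
rewrite addr0 [dotv _ 0]dotvC dot0v addr0 mulrAC; apply=> t /andP[t0 _].
rewrite scaler0 addr0 [dotv _ 0]dotvC dot0v add0r mulrAC.
apply: dotv_le; first exact: mulr_gt0.
have := enorm_le_sq (ltW L0) (lip (b + t *: v)).
rewrite [b + t *: v - b]addrAC subrr add0r !dotvE; lra.
Qed.

(** The Lipschitz bound controls only the joint norm of [(p, q)], so [dotv_le] cannot be used
    blockwise. Young with weight [2 * M * t] on each block yields two halves of
    [M * t * pnorm2 u v]. *)
Lemma descent a b u v M : 0 < M ->
  (forall a' b', pnorm2 (gH1 a' b' - gH1 a b) (gH2 a' b' - gH2 a b)
    <= M ^+ 2 * pnorm2 (a' - a) (b' - b)) ->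
  H (a + u) (b + v) <= H a b + dotv (gH1 a b) u + dotv (gH2 a b) v
    + M / 2 * pnorm2 u v.
Proof.
move=> M0 lip; rewrite mulrAC; apply: gradient_segment_le => // t /andP[t0 _].
have := lip (a + t *: u) (b + t *: v).
rewrite [a + t *: u - a]addrAC [b + t *: v - b]addrAC !subrr !add0r !pnorm2E.
set p := gH1 _ _ - _; set q := gH2 _ _ - _ => pq.
have c0 : 0 < M * t * 2 by rewrite !mulr_gt0.
have := young p u c0; have := young q v c0.
have : (M * t * 2)^-1 * (dotv p p + dotv q q)
    <= M * t / 2 * (dotv u u + dotv v v).
  rewrite mulrC ler_pdivrMr//; apply: le_trans pq _; rewrite !dotvE; lra.
rewrite mulrDr; lra.
Qed.
End Composite.

(** * Parameter inequalities and descent in one block *)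

Section Block.
Context {R : realType} {d : nat}.
Variables (eps abar bbar lam M S : R).
Hypotheses (eps0 : 0 < eps) (abarP : 0 < abar < (1 - eps) / 2)
  (lam0 : 0 < lam) (M0 : 0 < M) (S0 : 0 < S).
Let delta := ((M + lam) * abar + 2 * lam * bbar ^+ 2 + S) / (1 - 2 * abar - eps).
Variables (alpha beta L : R).
Hypotheses (alphaP : 0 <= alpha <= abar) (betaP : 0 <= beta <= bbar)
  (L0 : 0 < L) (Llam : L <= lam).
Let tau := ((1 + eps) * delta + M + L + S) / (1 - alpha).

Let delta_den_gt0 : 0 < 1 - 2 * abar - eps.
Proof. by case/andP: abarP; lra. Qed.

Let alpha_den_gt0 : 1 / 2 <= 1 - alpha.
Proof. by move: eps0; case/andP: abarP; case/andP: alphaP; lra. Qed.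

Let deltaE : delta * (1 - 2 * abar - eps)
  = (M + lam) * abar + 2 * lam * bbar ^+ 2 + S.
Proof. by rewrite divfK// gt_eqF. Qed.

(** The denominator of [delta] lies in (0,1) and its numerator is at least [S]. *)
Lemma delta_ge : S <= delta.
Proof.
rewrite ler_pdivlMr//; case/andP: abarP => a0 a1.
have h1 : 0 <= (M + lam) * abar.
  by rewrite mulr_ge0 ?addr_ge0 ?(ltW a0) ?(ltW M0) ?(ltW lam0)//.
have h2 : 0 <= 2 * lam * bbar ^+ 2.
  by rewrite mulr_ge0 ?sqr_ge0 ?mulr_ge0 ?(ltW lam0)//.
have h3 : 0 <= S * (2 * abar + eps).
  by rewrite mulr_ge0 ?addr_ge0 ?mulr_ge0 ?(ltW a0) ?(ltW S0) ?(ltW eps0)//.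
move: h1 h2 h3; lra.
Qed.

(** Since [alpha <= abar < (1 - eps) / 2], the denominator is at least [1 / 2]; with [L <= lam] the
    bound no longer depends on the iterate. *)
Lemma tau_bounds : 0 < tau <= 2 * ((1 + eps) * delta + M + lam + S).
Proof.
have ha := alpha_den_gt0.
have ed : 0 < (1 + eps) * delta.
  by rewrite mulr_gt0 ?addr_gt0// (lt_le_trans S0)// delta_ge.
apply/andP; split; first by apply: divr_gt0; [rewrite !addr_gt0|lra].
rewrite ler_pdivrMr; last by lra.
have : ((1 + eps) * delta + M + lam + S) * 1
    <= ((1 + eps) * delta + M + lam + S) * (2 * (1 - alpha)).
  rewrite ler_wpM2l//; last by lra.
  by rewrite !addr_ge0 ?(ltW ed) ?(ltW M0) ?(ltW lam0) ?(ltW S0).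
move: Llam; lra.
Qed.

(** This is what the formula for [delta] is made for. After multiplying by [1 - alpha], the worst
    case is [alpha = abar], [L = lam], [beta = bbar]; there [deltaE] leaves exactly the slack
    [(1 - abar) * (eps * delta)]. *)
Lemma inertia_coef_le : tau * alpha + 2 * L * beta ^+ 2 <= delta - S.
Proof.
have a0 : 0 < 1 - alpha by move: alpha_den_gt0; lra.
rewrite -(ler_pM2r a0) mulrDl mulrAC divfK ?gt_eqF//.
case/andP: alphaP => al0 al1; case/andP: abarP => ab0 ab1; case/andP: betaP => be0 be1.
have dS := delta_ge; have d0 : 0 < delta by exact: lt_le_trans S0 _.
have ed : 0 < (1 + eps) * delta by rewrite mulr_gt0 ?addr_gt0.
have h1 : ((1 + eps) * delta + M + L + S) * alpha
    <= ((1 + eps) * delta + M + lam + S) * abar.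
  rewrite ler_pM ?addr_ge0 ?(ltW ed) ?(ltW M0) ?(ltW S0) ?(ltW L0)//.
  by move: Llam; lra.
have h2 : 2 * L * beta ^+ 2 * (1 - alpha) <= 2 * lam * bbar ^+ 2.
  apply: (@le_trans _ _ (2 * L * beta ^+ 2)).
    by rewrite ler_piMr ?mulr_ge0 ?sqr_ge0 ?(ltW L0)//; lra.
  rewrite ler_pM ?mulr_ge0 ?sqr_ge0 ?(ltW L0)//; first by move: Llam; lra.
  by rewrite ler_sqr ?nnegrE// (le_trans be0).
have h3 : (delta - S) * (1 - abar) <= (delta - S) * (1 - alpha).
  by rewrite ler_wpM2l ?subr_ge0//; lra.
have h4 : 0 <= (1 - abar) * (eps * delta).
  apply: mulr_ge0; last by rewrite mulr_ge0 ?ltW.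
  by move: eps0; lra.
by move: h1 h2 h3 h4 deltaE; nra.
Qed.

(* Half of the modulus [M] absorbs the estimator error, the other half
   the extrapolation error [gx - gz]. *)
Lemma block_descent (x p xn G gx gz : 'rV[R]_d) (fx fxn Hx Hxn : R) :
  fxn + dotv G (xn - x) + 
    tau / 2 * dotv (xn - (x + alpha *: p)) (xn - (x + alpha *: p))
    <= fx +
    tau / 2 * dotv (x - (x + alpha *: p)) (x - (x + alpha *: p)) ->
  Hxn <= Hx + dotv gx (xn - x) + L / 2 * dotv (xn - x) (xn - x) ->
  dotv (gx - gz) (gx - gz) <= L ^+ 2 * (beta ^+ 2 * dotv p p) ->
  dotv (gx - gz) (gx - gz) <= M ^+ 2 * (beta ^+ 2 * dotv p p) ->
  Hxn + fxn <= Hx + fx + M^-1 * dotv (G - gz) (G - gz)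
    - (delta + S) / 2 * dotv (xn - x) (xn - x) + (delta - S) / 2 * dotv p p.
Proof.
move=> hprox hdesc hL hM.
have tauE : tau * (1 - alpha) = (1 + eps) * delta + M + L + S.
  by rewrite divfK// gt_eqF//; move: alpha_den_gt0; lra.
have /andP[tau0 _] := tau_bounds.
move: hprox hdesc; set dd := xn - x.
have -> : xn - (x + alpha *: p) = dd - alpha *: p by rewrite opprD addrA.
have -> : x - (x + alpha *: p) = - (alpha *: p) by rewrite opprD addrA subrr add0r.
move: dd => dd hprox hdesc.
have B0 : 0 <= beta ^+ 2 * dotv p p by rewrite mulr_ge0 ?sqr_ge0 ?dotvv_ge0.
(* Both Lipschitz constants apply, and the square of the smaller of [L] and [M] is at most
   [L * M]. *)
have hLM : M^-1 * dotv (gx - gz) (gx - gz) <= L * (beta ^+ 2 * dotv p p).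
  rewrite mulrC ler_pdivrMr//; have [LM|ML] := leP L M.
    apply: le_trans hL _; rewrite [leRHS]mulrAC ler_wpM2r// expr2.
    by rewrite ler_wpM2l// ltW.
  apply: le_trans hM _; rewrite [leRHS]mulrAC ler_wpM2r// expr2.
  by rewrite ler_wpM2r// ltW.
have y1 := young (gx - gz) dd M0.
have y2 := young (- (G - gz)) dd M0.
(* This square splits the inertial cross term [tau * alpha * dotv dd p]: the [dd] half leaves the
   coefficient [tau * (1 - alpha) / 2], and the [p] half goes into [inertia_coef_le]. *)
have c1 : 0 <= tau * alpha / 2 * dotv (dd - p) (dd - p).
  have /andP[al0 _] := alphaP.
  apply: mulr_ge0 (dotvv_ge0 _); apply: divr_ge0 => //.
  exact: mulr_ge0 (ltW tau0) al0.
have c2 := ler_wpM2r (dotvv_ge0 p) inertia_coef_le.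
have c3 : tau * (1 - alpha) * dotv dd dd = ((1 + eps) * delta + M + L + S) * dotv dd dd.
  by rewrite tauE.
have c4 : 0 <= eps * delta * dotv dd dd.
  apply: mulr_ge0 (dotvv_ge0 _); apply: mulr_ge0 (ltW eps0) _.
  exact: le_trans (ltW S0) delta_ge.
move: hprox hdesc hLM y1 y2 c1 c2 c3 c4.
have eN : dotv (- (G - gz)) (- (G - gz)) = dotv (G - gz) (G - gz).
  by rewrite dotvNl dotvNr opprK.
rewrite eN; move: (dotv (G - gz) (G - gz)) (dotv (gx - gz) (gx - gz)) => e1 e2.
rewrite !dotvE (dotvC p dd); move: M^-1 => Mi.
lra.
Qed.
End Block.

(** * Integration *)

(* [`phi > r`] is a countable union of rational boxes, since [phi] is continuous. *)
Lemma measurable_continuous_comp {R : realType} {dsp} {T : measurableType dsp}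
    {I : finType} (X : I -> T -> R) (phi : (I -> R) -> R) :
  (forall i, measurable_fun setT (X i)) ->
  (forall c (e : R), 0 < e -> exists2 dl : R, 0 < dl &
    forall c', (forall i, `|c' i - c i| < dl) -> `|phi c' - phi c| < e) ->
  measurable_fun setT (fun w => phi (X ^~ w)).
Proof.
move=> mX cphi; apply: (measurability _ (RGenOInfty.measurableE R)) => //.
move=> _ [_ [r ->] <-]; rewrite setTI.
pose box (q : {ffun I -> rat} * rat) (c : I -> R) :=
  forall i, `|c i - ratr (q.1 i)| < ratr q.2.
pose good q := forall c, box q c -> r < phi c.
have -> : (fun w => phi (X ^~ w)) @^-1` `]r, +oo[%classic
    = \bigcup_(q in [set: {ffun I -> rat} * rat])
        (if `[< good q >] then [set w | box q (X ^~ w)] else set0).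
  apply/seteqP; split=> w /=; rewrite ?in_itv /= ?andbT; last first.
    case=> q _; case: asboolP => // gq bq.
    exact: gq.
  move=> rw; have [|dl dl0 Hdl] := cphi (X ^~ w) (phi (X ^~ w) - r).
    by rewrite subr_gt0.
  (* With radius below [dl / 2], every point of a box containing [X ^~ w] is within [dl] of it in
     each coordinate. *)
  have [|e] := @rat_in_itvoo R 0 (dl / 2); first by rewrite divr_gt0.
  rewrite in_itv => /= /andP[e0 edl].
  have q_ex i : exists q : rat, `|X i w - ratr q| < ratr e.
    have [|q] := @rat_in_itvoo R (X i w - ratr e) (X i w + ratr e).
      by rewrite ltrBlDr -addrA ltrDl addr_gt0.
    rewrite in_itv => /= qe; exists q.
    by rewrite distrC ltr_distl.
  have [q qP] := choice q_ex.
  exists (finfun q, e) => //; rewrite asboolT => [|c bc].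
    by move=> i; rewrite ffunE; exact: qP.
  suff : `|phi c - phi (X ^~ w)| < phi (X ^~ w) - r.
    by rewrite ltr_distl => /andP[+ _]; rewrite subKr.
  apply: Hdl => i; have := qP i; have := bc i; rewrite /= ffunE => h1 h2.
  rewrite -(subrKA (ratr (q i))); apply: le_lt_trans (ler_normD _ _) _.
  rewrite (distrC (ratr _)); move: h1 h2 edl; lra.
apply: countable_bigcupT_measurable; first exact: countableP.
move=> q; case: asboolP => // _.
have -> : [set w | box q (X ^~ w)] = \bigcap_(i in [set: I])
    (X i @^-1` [set x | `|x - ratr (q.1 i)| < ratr q.2]).
  by apply/seteqP; split=> w; [move=> b i _; exact: b|move=> b i; exact: b].
apply: fin_bigcap_measurable => [|i _]; first exact: finite_finset.
rewrite -[X in measurable X]setTI; apply: mX => //.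
rewrite (_ : [set x | _] = `]ratr (q.1 i) - ratr q.2, ratr (q.1 i) + ratr q.2[%classic).
  exact: measurable_itv.
by apply/seteqP; split=> x /=; rewrite in_itv /= ltr_distl.
Qed.

Lemma measurable_lipschitz_comp {R : realType} {d1 d2 : nat} {dsp}
    {T : measurableType dsp} (X1 : T -> 'rV[R]_d1) (X2 : T -> 'rV[R]_d2)
    (phi : 'rV[R]_d1 -> 'rV[R]_d2 -> R) K : 0 <= K ->
  (forall i, measurable_fun setT (fun w => X1 w 0 i)) ->
  (forall i, measurable_fun setT (fun w => X2 w 0 i)) ->
  (forall a b a' b', (phi a' b' - phi a b) ^+ 2 <= K * pnorm2 (a' - a) (b' - b)) ->
  measurable_fun setT (fun w => phi (X1 w) (X2 w)).
Proof.
move=> K0 m1 m2 lip.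
pose X (i : 'I_d1 + 'I_d2) w :=
  match i with inl i => X1 w 0 i | inr j => X2 w 0 j end.
pose psi (c : 'I_d1 + 'I_d2 -> R) :=
  phi (\row_i c (inl i)) (\row_j c (inr j)).
have -> : (fun w => phi (X1 w) (X2 w)) = (fun w => psi (X ^~ w)).
  by apply/funext => w; congr phi; apply/rowP => i; rewrite mxE.
apply: measurable_continuous_comp => [[i|j]|c e e0]; [exact: m1|exact: m2|].
(* Moving each coordinate by less than [e / D] changes [phi] by less than [e], because
   [K * (d1 + d2) < D <= D ^+ 2]. *)
pose D := K * (d1%:R + d2%:R) + 1.
have D0 : 0 < D by rewrite ltr_wpDl// mulr_ge0// addr_ge0.
have D1 : 1 <= D by rewrite lerDr mulr_ge0// addr_ge0.
exists (e / D); first exact: divr_gt0.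
move=> c' cc'; rewrite -(@ltr_pXn2r _ 2)// ?nnegrE ?(ltW e0)// real_normK ?num_real//.
apply: le_lt_trans (lip _ _ _ _) _.
have sq k (x y : 'I_k -> R) : (forall i, `|x i - y i| < e / D) ->
    dotv (\row_i x i - \row_i y i) (\row_i x i - \row_i y i) <= k%:R * (e / D) ^+ 2.
  move=> xy; rewrite mulr_natl -[k in leRHS]card_ord -sumr_const ler_sum// => i _.
  rewrite !mxE -expr2 -real_normK ?num_real// ler_sqr ?nnegrE//.
    exact: ltW.
  by rewrite ltW// divr_gt0.
have h1 := sq _ _ _ (fun i => cc' (inl i)).
have h2 := sq _ _ _ (fun i => cc' (inr i)).
rewrite pnorm2E; apply: le_lt_trans (ler_wpM2l K0 (lerD h1 h2)) _.
rewrite -mulrDl mulrA expr_div_n mulrA ltr_pdivrMr ?exprn_gt0//.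
rewrite [ltRHS]mulrC ltr_pM2r ?exprn_gt0//.
apply: (@lt_le_trans _ _ D); first by rewrite ltrDl.
by rewrite expr2 ler_peMr// ltW.
Qed.

Section Expectation.
Context {R : realType} {dsp : measure_display} {T : measurableType dsp}.
Variable P : probability T R.

(* The integral of a nonnegative function is a supremum over simple minorants,
   hence monotone without any measurability. *)
Lemma integral_le_ge0 (f g : T -> \bar R) : (forall w, 0 <= f w)%E ->
  (forall w, f w <= g w)%E -> (\int[P]_w f w <= \int[P]_w g w)%E.
Proof.
move=> f0 fg; have g0 w : (0 <= g w)%E by exact: le_trans (f0 w) (fg w).
rewrite !ge0_integralTE//; apply: ereal_sup_le => _ [h hf <-].
by exists h => // w; exact: le_trans (hf w) (fg w).
Qed.

Definition Rintegrable (X : T -> R) := P.-integrable setT (EFin \o X).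
Definition mean (X : T -> R) : R := (\int[P]_w X w)%R.

Lemma EFin_mean X : Rintegrable X -> (\int[P]_w (X w)%:E)%E = (mean X)%:E.
Proof. by move=> iX; rewrite fineK//; exact: integrable_fin_num. Qed.

Lemma RintegrableD X Y : Rintegrable X -> Rintegrable Y ->
  Rintegrable (fun w => X w + Y w).
Proof. by move=> iX iY; have := integrableD measurableT iX iY. Qed.

Lemma RintegrableZ c X : Rintegrable X -> Rintegrable (fun w => c * X w).
Proof. by move=> iX; have := integrableZl measurableT c iX. Qed.

Lemma Rintegrable_cst c : Rintegrable (fun=> c).
Proof.
apply: measurable_bounded_integrable => //.
  by rewrite (@le_lt_trans _ _ 1%E) ?ltry// probability_le1.
exact: bounded_cst.
Qed.

Lemma meanD X Y : Rintegrable X -> Rintegrable Y ->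
  mean (fun w => X w + Y w) = mean X + mean Y.
Proof. exact: RintegralD. Qed.

Lemma meanZ c X : Rintegrable X -> mean (fun w => c * X w) = c * mean X.
Proof. exact: RintegralZl. Qed.

Lemma mean_cst c : mean (fun=> c) = c.
Proof.
rewrite /mean Rintegral_cst// -[RHS]mulr1; congr (_ * _).
by rewrite -[RHS]/(fine 1%E); congr fine; exact: probability_setT.
Qed.

Lemma mean_ge0 (X : T -> R) : (forall w, 0 <= X w) -> 0 <= mean X.
Proof. by move=> X0; exact: Rintegral_ge0. Qed.

Lemma mean_le (X Y : T -> R) : Rintegrable X -> Rintegrable Y ->
  (forall w, X w <= Y w) -> mean X <= mean Y.
Proof. by move=> iX iY XY; exact: le_Rintegral. Qed.

Lemma Rintegrable_sum (X : nat -> T -> R) n :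
  (forall k, (k < n)%N -> Rintegrable (X k)) ->
  Rintegrable (fun w => \sum_(k < n) X k w).
Proof.
elim: n => [|n IH] iX.
  by under eq_fun do rewrite big_ord0; exact: Rintegrable_cst.
under eq_fun do rewrite big_ord_recr.
by apply: RintegrableD; [apply: IH => k kn; exact/iX/ltnW|exact: iX].
Qed.

Lemma mean_sum (X : nat -> T -> R) n :
  (forall k, (k < n)%N -> Rintegrable (X k)) ->
  mean (fun w => \sum_(k < n) X k w) = \sum_(k < n) mean (X k).
Proof.
elim: n => [|n IH] iX.
  by under eq_fun do rewrite big_ord0; rewrite mean_cst big_ord0.
under eq_fun do rewrite big_ord_recr.
have iX' k : (k < n)%N -> Rintegrable (X k) by move=> kn; exact/iX/ltnW.
by rewrite meanD ?IH ?big_ord_recr//; [exact: Rintegrable_sum|exact: iX].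
Qed.

(** [Y - X] agrees almost everywhere with its positive part, whose integral is nonnegative. *)
Lemma ae_mean_le (X Y : T -> R) : Rintegrable X -> Rintegrable Y ->
  {ae P, forall w, X w <= Y w} -> mean X <= mean Y.
Proof.
move=> iX iY XY; rewrite -subr_ge0.
pose h w := ((Y w - X w)%:E)%E.
have ih : P.-integrable setT h by have := integrableB measurableT iY iX.
have mh : measurable_fun setT h by case/integrableP : ih.
have -> : mean Y - mean X = fine (\int[P]_w h w)%E by exact/esym/RintegralB.
rewrite (ae_eq_integral h^\+)%E//.
- by apply: fine_ge0; apply: integral_ge0 => w _; exact: funepos_ge0.
- exact: measurable_funepos.
- apply: filterS XY => w XYw _; rewrite funeposE; apply/esym/max_idPl.
  by rewrite lee_fin subr_ge0.
Qed.

(** Test the defining identity on the whole space. Integrability of [X] is a conclusion: it is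
    measurable and its integral equals the finite one of [Z]. *)
Lemma cond_exp_mean G (X Z : T -> R) :
  measurable_fun setT X -> G setT -> is_cond_exp P G X Z ->
  [/\ Rintegrable X, Rintegrable Z & mean X = mean Z].
Proof.
move=> mX GT [_ [iZ /(_ _ GT) XZ]]; split=> //; last by rewrite /mean /Rintegral XZ.
apply/integrableP; split; first exact/measurable_EFinP.
by rewrite integral_fin_num_abs// XZ; exact: integrable_fin_num.
Qed.

Lemma cond_exp_bound G (X Y U W ZX ZY : T -> R) (c d : R) :
  measurable_fun setT X -> measurable_fun setT Y -> G setT ->
  is_cond_exp P G X ZX -> is_cond_exp P G Y ZY -> Rintegrable U -> Rintegrable W ->
  {ae P, forall w, ZX w <= d * U w + c * (ZY w + W w)} ->
  mean X <= d * mean U + c * (mean Y + mean W).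
Proof.
move=> mX mY GT /(cond_exp_mean mX GT)[_ iZX ->] /(cond_exp_mean mY GT)[_ iZY ->].
move=> iU iW /ae_mean_le le; rewrite -meanD// -!meanZ//; last exact: RintegrableD.
rewrite -meanD; [|exact: RintegrableZ|by apply/RintegrableZ/RintegrableD].
apply: le => //; apply: RintegrableD; first exact: RintegrableZ.
by apply/RintegrableZ/RintegrableD.
Qed.
End Expectation.

(** * One iteration, and summability of the increments *)

Section Step.
Context {R : realType} {d1 d2 : nat}.
Variables (H : 'rV[R]_d1 -> 'rV[R]_d2 -> R)
  (gH1 : 'rV[R]_d1 -> 'rV[R]_d2 -> 'rV[R]_d1)
  (gH2 : 'rV[R]_d1 -> 'rV[R]_d2 -> 'rV[R]_d2)
  (f : 'rV[R]_d1 -> \bar R) (g : 'rV[R]_d2 -> \bar R)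
  (L1 : 'rV[R]_d2 -> R) (L2 : 'rV[R]_d1 -> R)
  (M S eps lam1 lam2 abar1 abar2 bbar1 bbar2 : R).
Hypotheses (gH : is_gradient H gH1 gH2)
  (gHM : forall a b a' b', pnorm2 (gH1 a b - gH1 a' b') (gH2 a b - gH2 a' b')
    <= M ^+ 2 * pnorm2 (a - a') (b - b'))
  (fP : proper_fun f) (gP : proper_fun g)
  (gHL1 : forall v u u', enorm (gH1 u v - gH1 u' v) <= L1 v * enorm (u - u'))
  (gHL2 : forall u v v', enorm (gH2 u v - gH2 u v') <= L2 u * enorm (v - v'))
  (M0 : 0 < M) (S0 : 0 < S) (eps0 : 0 < eps) (lam10 : 0 < lam1) (lam20 : 0 < lam2)
  (abar1P : 0 < abar1 < (1 - eps) / 2) (abar2P : 0 < abar2 < (1 - eps) / 2)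
  (bbar1P : 0 < bbar1 <= 1) (bbar2P : 0 < bbar2 <= 1).

Let delta1 := ((M + lam1) * abar1 + 2 * lam1 * bbar1 ^+ 2 + S) / (1 - 2 * abar1 - eps).
Let delta2 := ((M + lam2) * abar2 + 2 * lam2 * bbar2 ^+ 2 + S) / (1 - 2 * abar2 - eps).
Let T1 := 2 * ((1 + eps) * delta1 + M + lam1 + S).
Let T2 := 2 * ((1 + eps) * delta2 + M + lam2 + S).
Let F u v := ((H u v)%:E + f u + g v)%E.

Variables (alpha1 alpha2 beta1 beta2 : R).
Hypotheses (alpha1P : 0 <= alpha1 <= abar1) (alpha2P : 0 <= alpha2 <= abar2)
  (beta1P : 0 <= beta1 <= bbar1) (beta2P : 0 <= beta2 <= bbar2).
(* Previous, current and next iterates, and the estimated partial gradients. *)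
Variables (x1m x1 x1p G1 : 'rV[R]_d1) (x2m x2 x2p G2 : 'rV[R]_d2).
Hypotheses (L1P : 0 < L1 x2 <= lam1) (L2P : 0 < L2 x1p <= lam2).
Let tau1 := ((1 + eps) * delta1 + M + L1 x2 + S) / (1 - alpha1).
Let tau2 := ((1 + eps) * delta2 + M + L2 x1p + S) / (1 - alpha2).
Let y1 := x1 + alpha1 *: (x1 - x1m).
Let z1 := x1 + beta1 *: (x1 - x1m).
Let y2 := x2 + alpha2 *: (x2 - x2m).
Let z2 := x2 + beta2 *: (x2 - x2m).
Hypotheses (x1pP : x1p \in prox tau1 f (y1 - tau1^-1 *: G1))
  (x2pP : x2p \in prox tau2 g (y2 - tau2^-1 *: G2)).
Let err := enorm (G1 - gH1 z1 x2) ^+ 2 + enorm (G2 - gH2 x1p z2) ^+ 2.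

Let tau1P : 0 < tau1 <= T1.
Proof. by case/andP: L1P => ? ?; exact: tau_bounds alpha1P _ _. Qed.

Let tau2P : 0 < tau2 <= T2.
Proof. by case/andP: L2P => ? ?; exact: tau_bounds alpha2P _ _. Qed.

Let inertia_sq d (a b : R) (x xm xp : 'rV[R]_d) : 0 <= a -> a <= b -> b <= 1 ->
  dotv (x + a *: (x - xm) - xp) (x + a *: (x - xm) - xp)
    <= 2 * (dotv (xp - x) (xp - x) + dotv (x - xm) (x - xm)).
Proof.
move=> a0 ab b1; rewrite addrAC -opprB addrC; apply: le_trans (dotv_sqB _ _) _.
rewrite ler_pM2l// addrC lerD2l dotvZl dotvZr mulrA -[leRHS]mul1r.
by rewrite ler_wpM2r ?dotvv_ge0// mulr_ile1// (le_trans ab).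
Qed.

Let lerDl_dotv d d' (u : 'rV[R]_d) (v : 'rV[R]_d') : dotv u u <= dotv u u + dotv v v.
Proof. by rewrite lerDl dotvv_ge0. Qed.

Let lerDr_dotv d d' (u : 'rV[R]_d) (v : 'rV[R]_d') : dotv v v <= dotv u u + dotv v v.
Proof. by rewrite lerDr dotvv_ge0. Qed.

(** Add the descents of the two blocks. The second one is taken at the updated [x1p], so the
    intermediate value [H x1p x2] cancels. *)
Lemma step_descent : f x1 \is a fin_num -> g x2 \is a fin_num ->
  H x1p x2p + fine (f x1p) + fine (g x2p)
    + (delta1 / 2 * dotv (x1p - x1) (x1p - x1) + delta2 / 2 * dotv (x2p - x2) (x2p - x2))
    + S / 2 * (pnorm2 (x1p - x1) (x2p - x2) + pnorm2 (x1 - x1m) (x2 - x2m))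
  <= H x1 x2 + fine (f x1) + fine (g x2)
    + (delta1 / 2 * dotv (x1 - x1m) (x1 - x1m) + delta2 / 2 * dotv (x2 - x2m) (x2 - x2m))
    + M^-1 * err.
Proof.
move=> fx gx; have /andP[t1 _] := tau1P; have /andP[t2 _] := tau2P.
have /andP[L10 L1l] := L1P; have /andP[L20 L2l] := L2P.
have p1 := prox_le fP t1 x1pP fx; have p2 := prox_le gP t2 x2pP gx.
have lip1 : H (x1 + (x1p - x1)) x2 <= _ := descent_fst gH (x1p - x1) L10
  (fun a' => gHL1 x2 a' x1).
have lip2 : H x1p (x2 + (x2p - x2)) <= _ := descent_snd gH (x2p - x2) L20
  (fun b' => gHL2 x1p b' x2).
rewrite subrKC in lip1; rewrite subrKC in lip2.
have zE1 : x1 - z1 = - beta1 *: (x1 - x1m) by rewrite opprD addrA subrr add0r scaleNr.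
have zE2 : x2 - z2 = - beta2 *: (x2 - x2m) by rewrite opprD addrA subrr add0r scaleNr.
have h1L := enorm_le_sq (ltW L10) (gHL1 x2 x1 z1).
have h2L := enorm_le_sq (ltW L20) (gHL2 x1p x2 z2).
have h1M := gHM x1 x2 z1 x2; have h2M := gHM x1p x2 x1p z2.
have sqE d b (p : 'rV[R]_d) : dotv (- b *: p) (- b *: p) = b ^+ 2 * dotv p p.
  by rewrite dotvZl dotvZr mulrA mulrNN expr2.
rewrite zE1 sqE in h1L; rewrite zE2 sqE in h2L.
rewrite !pnorm2E subrr dot0v addr0 zE1 sqE in h1M.
rewrite !pnorm2E subrr dot0v add0r zE2 sqE in h2M.
have {}h1M := le_trans (lerDl_dotv _ _) h1M.
have {}h2M := le_trans (lerDr_dotv _ _) h2M.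
have b1 := block_descent eps0 abar1P lam10 M0 S0 alpha1P beta1P L10 L1l
  p1 lip1 h1L h1M.
have b2 := block_descent eps0 abar2P lam20 M0 S0 alpha2P beta2P L20 L2l
  p2 lip2 h2L h2M.
rewrite /err !pnorm2E !enorm2E.
move: b1 b2; rewrite -/delta1 -/delta2; move: M^-1 => Mi; lra.
Qed.

(** Each block of the subgradient is a gradient difference, an estimator error and a proximal
    displacement. The square of a sum of three costs a factor 3, and each extrapolated difference is
    at most twice the increments, whence [3 * (2 * M ^+ 2 + 2 * M ^+ 2 + 2 * T1 ^+ 2 + 2 * T2 ^+
    2)]. *)
Lemma dist_bound : 
  (dist0 (limiting_subdiff F x1p x2p) * dist0 (limiting_subdiff F x1p x2p)
   <= ((12 * M ^+ 2 + 6 * T1 ^+ 2 + 6 * T2 ^+ 2)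
      * (pnorm2 (x1p - x1) (x2p - x2) + pnorm2 (x1 - x1m) (x2 - x2m)) + 3 * err)%:E)%E.
Proof.
have /andP[t1 t1T] := tau1P; have /andP[t2 t2T] := tau2P.
have := dist0_sq_le (frechet_subset_limiting (frechet_composite gH
  (prox_fin_num fP x1pP) (prox_fin_num gP x2pP)
  (fun z => prox_subgradient fP z t1 x1pP) (fun z => prox_subgradient gP z t2 x2pP))).
move=> /le_trans; apply; rewrite lee_fin /=.
have -> : gH1 x1p x2p + (tau1 *: (y1 - x1p) - G1)
    = (gH1 x1p x2p - gH1 z1 x2) + - (G1 - gH1 z1 x2) + tau1 *: (y1 - x1p).
  by rewrite opprB subrKA addrA addrAC.
have -> : gH2 x1p x2p + (tau2 *: (y2 - x2p) - G2)
    = (gH2 x1p x2p - gH2 x1p z2) + - (G2 - gH2 x1p z2) + tau2 *: (y2 - x2p).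
  by rewrite opprB subrKA addrA addrAC.
have /andP[a10 a1b] := alpha1P; have /andP[a20 a2b] := alpha2P.
have /andP[b10 b1b] := beta1P; have /andP[b20 b2b] := beta2P.
have /andP[_ bb1] := bbar1P; have /andP[_ bb2] := bbar2P.
have ab1 : abar1 <= 1 by case/andP: abar1P; move: eps0; lra.
have ab2 : abar2 <= 1 by case/andP: abar2P; move: eps0; lra.
set Q := _ + pnorm2 (x1 - x1m) _.
have QE : Q = (dotv (x1p - x1) (x1p - x1) + dotv (x1 - x1m) (x1 - x1m))
            + (dotv (x2p - x2) (x2p - x2) + dotv (x2 - x2m) (x2 - x2m)).
  by rewrite /Q !pnorm2E; ring.
have Q1 : dotv (x1p - x1) (x1p - x1) + dotv (x1 - x1m) (x1 - x1m) <= Q.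
  by rewrite QE lerDl addr_ge0 ?dotvv_ge0.
have Q2 : dotv (x2p - x2) (x2p - x2) + dotv (x2 - x2m) (x2 - x2m) <= Q.
  by rewrite QE lerDr addr_ge0 ?dotvv_ge0.
have symm d (u v : 'rV[R]_d) : dotv (u - v) (u - v) = dotv (v - u) (v - u).
  by rewrite -(opprB v) dotvNl dotvNr opprK.
have i1 : dotv (x1p - z1) (x1p - z1)
    <= 2 * (dotv (x1p - x1) (x1p - x1) + dotv (x1 - x1m) (x1 - x1m)).
  by rewrite symm; exact: inertia_sq b10 b1b bb1.
have i2 : dotv (x2p - z2) (x2p - z2)
    <= 2 * (dotv (x2p - x2) (x2p - x2) + dotv (x2 - x2m) (x2 - x2m)).
  by rewrite symm; exact: inertia_sq b20 b2b bb2.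
have j1 : dotv (y1 - x1p) (y1 - x1p) <= 2 * Q.
  by apply: le_trans (inertia_sq _ _ _ a10 a1b ab1) _; rewrite ler_pM2l.
have j2 : dotv (y2 - x2p) (y2 - x2p) <= 2 * Q.
  by apply: le_trans (inertia_sq _ _ _ a20 a2b ab2) _; rewrite ler_pM2l.
have k1 : dotv (gH1 x1p x2p - gH1 z1 x2) (gH1 x1p x2p - gH1 z1 x2)
    <= M ^+ 2 * (2 * Q).
  have := gHM x1p x2p z1 x2; rewrite [X in X <= _ -> _]pnorm2E.
  move/(le_trans (lerDl_dotv _ _))/le_trans; apply; rewrite ler_wpM2l ?sqr_ge0//.
  rewrite pnorm2E QE; move: i1 (dotvv_ge0 (x2p - x2)) (dotvv_ge0 (x2 - x2m)); lra.
have k2 : dotv (gH2 x1p x2p - gH2 x1p z2) (gH2 x1p x2p - gH2 x1p z2)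
    <= M ^+ 2 * (2 * Q).
  have := gHM x1p x2p x1p z2; rewrite [X in X <= _ -> _]pnorm2E.
  move/(le_trans (lerDr_dotv _ _))/le_trans; apply; rewrite ler_wpM2l ?sqr_ge0//.
  rewrite pnorm2E subrr dot0v add0r; apply: le_trans i2 _; rewrite ler_pM2l//.
have Q0 : 0 <= 2 * Q by rewrite mulr_ge0// (le_trans _ Q1)// addr_ge0 ?dotvv_ge0.
have m1 : tau1 ^+ 2 * dotv (y1 - x1p) (y1 - x1p) <= T1 ^+ 2 * (2 * Q).
  by rewrite ler_pM ?sqr_ge0 ?dotvv_ge0// lerXn2r ?nnegrE ?(ltW t1)//
    (le_trans (ltW t1)).
have m2 : tau2 ^+ 2 * dotv (y2 - x2p) (y2 - x2p) <= T2 ^+ 2 * (2 * Q).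
  by rewrite ler_pM ?sqr_ge0 ?dotvv_ge0// lerXn2r ?nnegrE ?(ltW t2)//
    (le_trans (ltW t2)).
rewrite pnorm2E; apply: le_trans (lerD (dotv_sqD3 _ _ _) (dotv_sqD3 _ _ _)) _.
rewrite /err !enorm2E; move: k1 k2 m1 m2.
set A1 := gH1 _ _ - gH1 _ _; set A2 := gH2 _ _ - gH2 _ _.
set B1 := G1 - _; set B2 := G2 - _.
rewrite !dotvNl !dotvNr !opprK !dotvZl !dotvZr.
move: (dotv A1 A1) (dotv A2 A2) (dotv B1 B1) (dotv B2 B2)
  (dotv (y1 - _) _) (dotv (y2 - _) _) => ? ? ? ? ? ?.
lra.
Qed.

(** Base of the telescoping sum. The inertia vanishes here, and the constants are crude: what
    matters is that the right side is affine in the squared increment and [err], with all other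
    terms fixed by the starting point and [v1], [v2]. *)
Lemma first_step_bound v1 v2 : x1m = x1 -> x2m = x2 ->
  f v1 \is a fin_num -> g v2 \is a fin_num ->
  H x1p x2p + fine (f x1p) + fine (g x2p) <=
  H x1 x2 + fine (f v1) + fine (g v2)
    + (T1 / 2 + 1) * dotv (v1 - x1) (v1 - x1) + (T2 / 2 + 1) * dotv (v2 - x2) (v2 - x2)
    + 2 * dotv (gH1 x1 x2) (gH1 x1 x2) + 3 * dotv (gH2 x1 x2) (gH2 x1 x2)
    + (3 / 2 + M / 2 + 2 * M ^+ 2) * pnorm2 (x1p - x1) (x2p - x2) + err.
Proof.
move=> x1mE x2mE fv gv; have /andP[t1 t1T] := tau1P; have /andP[t2 t2T] := tau2P.
have y1E : y1 = x1 by rewrite /y1 x1mE subrr scaler0 addr0.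
have y2E : y2 = x2 by rewrite /y2 x2mE subrr scaler0 addr0.
have z1E : z1 = x1 by rewrite /z1 x1mE subrr scaler0 addr0.
have z2E : z2 = x2 by rewrite /z2 x2mE subrr scaler0 addr0.
have := prox_le fP t1 x1pP fv; have := prox_le gP t2 x2pP gv.
rewrite y1E y2E => p2 p1.
have hH := descent gH (x1p - x1) (x2p - x2) M0 (fun a' b' => gHM a' b' x1 x2).
rewrite !subrKC in hH.
have half d (u v : 'rV[R]_d) : dotv u v <= 2^-1 * dotv u u + 2^-1 * dotv v v.
  by have := dotvv_ge0 (u - v); rewrite !dotvE (dotvC v u); lra.
(* [c] stands for the true gradient: Young on [dotv G (xp - v)] gives half the square of [G], split
   into the error [G - c] and [c]. *)
have block d (t T : R) (G xp x v c : 'rV[R]_d) (fp fv' : R) : 0 < t -> t <= T ->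
    fp + dotv G (xp - v) + t / 2 * dotv (xp - x) (xp - x)
      <= fv' + t / 2 * dotv (v - x) (v - x) ->
    fp <= fv' + (T / 2 + 1) * dotv (v - x) (v - x) + dotv (xp - x) (xp - x)
      + dotv (G - c) (G - c) + dotv c c.
  move=> t0 tT h.
  have h1 := half _ (- G) (xp - v).
  have h2 := dotv_sqD (G - c) c; rewrite subrK in h2.
  have h3 := dotv_sqB (xp - x) (v - x).
  have E3 : xp - x - (v - x) = xp - v by rewrite opprB addrA subrK.
  rewrite E3 in h3; rewrite dotvNl (dotvNl G) dotvNr opprK in h1.
  have h4 : t * dotv (v - x) (v - x) <= T * dotv (v - x) (v - x).
    by rewrite ler_wpM2r ?dotvv_ge0.
  have h5 : 0 <= t * dotv (xp - x) (xp - x) by rewrite mulr_ge0 ?dotvv_ge0 ?(ltW t0).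
  by move: h h1 h2 h3 h4 h5; lra.
have b1 := block _ _ _ _ _ _ _ (gH1 z1 x2) _ _ t1 t1T p1.
have b2 := block _ _ _ _ _ _ _ (gH2 x1p z2) _ _ t2 t2T p2.
rewrite z1E in b1; rewrite z2E in b2.
have h1 := half _ (gH1 x1 x2) (x1p - x1); have h2 := half _ (gH2 x1 x2) (x2p - x2).
(* The second block uses the gradient at [(x1p, x2)]; Lipschitz continuity brings it back to the
   starting point [(x1, x2)]. *)
have h3 := gHM x1p x2 x1 x2.
rewrite !pnorm2E [x2 - x2]subrr dot0v addr0 in h3.
have h4 := dotv_sqD (gH2 x1p x2 - gH2 x1 x2) (gH2 x1 x2); rewrite subrK in h4.
have h5 := dotvv_ge0 (gH1 x1p x2 - gH1 x1 x2).
have h6 := mulr_ge0 (sqr_ge0 M) (dotvv_ge0 (x2p - x2)).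
have h7 := dotvv_ge0 (gH1 x1 x2); have h8 := dotvv_ge0 (gH2 x1 x2).
rewrite pnorm2E in hH.
rewrite /err z1E z2E !enorm2E pnorm2E.
move: (dotv (gH2 x1p x2 - _) _) h3 h4 => A h3 h4.
move: (dotv (gH1 x1p x2 - _) _) h3 h5 => A' h3 h5.
move: (dotv (x1p - x1) (x1p - x1)) (dotv (x2p - x2) (x2p - x2))
  b1 b2 hH h1 h2 h3 h6 => D1 D2.
move=> b1 b2 hH h1 h2 h3 h6; lra.
Qed.

End Step.

(* The hypotheses give [rho U <= (U_k - U_{k+1}) + VU (...)], which telescopes, so
   that the error contributes at most [(rho V1 + VU) / (rho M) <= S / 4] times
   three shifted copies of [\sum p], fewer than the four available. *)
Lemma increments_cvg0 {R : realType} (p e u : nat -> R) (V1 VU rho M S veps B : R) :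
  S = 4 * ((rho * V1 + VU) / (rho * M)) + veps ->
  0 <= V1 -> 0 <= VU -> 0 < rho -> 0 < M -> 0 < veps ->
  (forall k, 0 <= p k) -> (forall k, 0 <= u k) ->
  (forall k, e k.+1 <= u k.+1 + V1 * (p k.+2 + (p k.+1 + p k))) ->
  (forall k, u k.+2 <= (1 - rho) * u k.+1 + VU * (p k.+2 + (p k.+1 + p k))) ->
  (forall n, S / 2 * \sum_(k < n) (p k.+2 + p k.+1) <= B + M^-1 * \sum_(k < n) e k.+1) ->
  p @ \oo --> 0.
Proof.
move=> SE V10 VU0 rho0 M0 veps0 p0 u0 he hu hB.
pose kappa := (rho * V1 + VU) / (rho * M).
have k0 : 0 <= kappa by rewrite divr_ge0 ?addr_ge0 ?mulr_ge0 ?(ltW rho0) ?(ltW M0).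
have rM0 : 0 <= (rho * M)^-1 by rewrite invr_ge0 mulr_ge0 ?(ltW rho0) ?(ltW M0).
pose s n := \sum_(k < n) p k.+2.
have s_ge n : 0 <= s n by exact: sumr_ge0.
have tel n : M^-1 * \sum_(k < n) e k.+1 + (rho * M)^-1 * u n.+1
    <= (rho * M)^-1 * u 1%N + kappa * \sum_(k < n) (p k.+2 + (p k.+1 + p k)).
  elim: n => [|n IH]; first by rewrite !big_ord0 !mulr0 add0r addr0.
  rewrite !big_ord_recr /=; set t := p n.+2 + _.
  have h1 : M^-1 * e n.+1 <= M^-1 * (u n.+1 + V1 * t).
    by rewrite ler_wpM2l ?invr_ge0 ?(ltW M0)//; exact: he.
  have h2 : (rho * M)^-1 * u n.+2 <= (rho * M)^-1 * ((1 - rho) * u n.+1 + VU * t).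
    by rewrite ler_wpM2l//; exact: hu.
  (* The weight [(rho * M)^-1] makes the sum telescope: [M^-1 + (rho * M)^-1 * (1 - rho) = (rho *
     M)^-1]. *)
  have h3 : M^-1 * (u n.+1 + V1 * t) + (rho * M)^-1 * ((1 - rho) * u n.+1 + VU * t)
      = (rho * M)^-1 * u n.+1 + kappa * t.
    by rewrite /kappa; field; rewrite !gt_eqF.
  move: IH h1 h2 h3; lra.
have shift1 n : \sum_(k < n) p k.+1 <= s n + p 1%N.
  case: n => [|n]; first by rewrite /s !big_ord0 add0r.
  rewrite big_ord_recl /s big_ord_recr /= [leLHS]addrC lerD2r lerDl; exact: p0.
have shift0 n : \sum_(k < n) p k <= \sum_(k < n) p k.+1 + p 0%N.
  case: n => [|n]; first by rewrite !big_ord0 add0r.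
  rewrite big_ord_recl big_ord_recr /= [leLHS]addrC lerD2r lerDl; exact: p0.
(* As [S / 2 = 2 * kappa + veps / 2], the [kappa] terms are absorbed and [veps / 2 * s n] is left on
   the left side. *)
pose C := (B + (rho * M)^-1 * u 1%N + kappa * p 0%N) / (veps / 2).
have s_le n : s n <= C.
  rewrite ler_pdivlMr ?divr_gt0//; have := tel n; have := hB n.
  have r0 : 0 <= (rho * M)^-1 * u n.+1 by rewrite mulr_ge0.
  have s1 : 0 <= \sum_(k < n) p k.+1 by exact: sumr_ge0.
  have := ler_wpM2l k0 (shift0 n).
  rewrite SE -/kappa !big_split /= -/(s n) => h1 h2 h3.
  have h4 := mulr_ge0 k0 (s_ge n); have h5 := mulr_ge0 k0 s1.
  have h6 := mulr_ge0 (ltW veps0) s1.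
  move: h1 h2 h3 r0 h4 h5 h6; rewrite !mulrDr; lra.
have s_cvg : cvgn (series (fun k => p k.+2)).
  apply: nondecreasing_is_cvgn.
    by apply: nondecreasing_series => k _ _; exact: p0.
  exists C => _ [n _ <-]; rewrite /series /= big_mkord; exact: s_le.
have := cvg_series_cvg_0 s_cvg.
by rewrite (cvg_shiftS (fun k => p k.+1)) (cvg_shiftS p).
Qed.

(** * From pathwise bounds to expectations and convergence *)

Lemma measurable_enorm2 {R : realType} {dsp} {T : measurableType dsp} {d : nat}
    (X : T -> 'rV[R]_d) : (forall i, measurable_fun setT (fun w => X w 0 i)) ->
  measurable_fun setT (fun w => enorm (X w) ^+ 2).
Proof.
move=> mX; under eq_fun do rewrite enorm2E.
by apply: measurable_sum => i; apply: measurable_funM.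
Qed.

Lemma weighted_le {R : realType} (a b x y : R) :
  0 <= a -> 0 <= b -> 0 <= x -> 0 <= y ->
  a * x + b * y <= (a + b) * (x + y).
Proof. by move=> a0 b0 x0 y0; rewrite mulrDr lerD// ler_wpM2r// ?lerDl ?lerDr. Qed.

Lemma combine_le {R : realType} (c v e u a b b' : R) : 0 <= c -> 0 <= b' ->
  e <= u + v * (a + (b + b')) ->
  c * (a + b) + 3 * e <= (c + 3 * v) * (a + (b + b')) + 3 * u.
Proof. by move=> c0 b0; have := mulr_ge0 c0 b0; lra. Qed.

Lemma cvg_EFin_fun {R : realType} (u : nat -> R) (l : R) :
  u @ \oo --> l -> (fun k => (u k)%:E) @ \oo --> l%:E.
Proof. by move=> ul; apply: cvg_EFin => //; exact: nearW. Qed.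

Lemma coord_sqr_le {R : realType} {d : nat} (u : 'rV[R]_d) i :
  u 0 i ^+ 2 <= dotv u u.
Proof.
rewrite /dotv (bigD1 i)//= -expr2 lerDl sumr_ge0// => j _.
by rewrite -expr2 sqr_ge0.
Qed.

Lemma gen_sigmaT {R : realType} {dsp} {Omega : measurableType dsp} {d1 d2 : nat}
    (x1 : nat -> Omega -> 'rV[R]_d1) (x2 : nat -> Omega -> 'rV[R]_d2) k :
  gen_sigma x1 x2 k setT.
Proof.
rewrite -setC0 -setTD; have [s0 sC _] := smallest_sigma_algebra setT
  [set A | exists j, (j <= k)%N /\
        ((exists (i : 'I_d1) (B : set R), measurable B /\
            A = (fun w => x1 j w 0 i) @^-1` B) \/
         (exists (i : 'I_d2) (B : set R), measurable B /\
            A = (fun w => x2 j w 0 i) @^-1` B))].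
exact: sC.
Qed.

Theorem theorem5p4
  (R : realType) (d1 d2 n : nat)
  (* the smooth part H = 1/n sum_i h_i, each h_i with globally M-Lipschitz gradient *)
  (h : 'I_n -> 'rV[R]_d1 -> 'rV[R]_d2 -> R)
  (Dh1 : 'I_n -> 'rV[R]_d1 -> 'rV[R]_d2 -> 'rV[R]_d1)
  (Dh2 : 'I_n -> 'rV[R]_d1 -> 'rV[R]_d2 -> 'rV[R]_d2)
  (M : R)
  (* nonsmooth parts *)
  (f : 'rV[R]_d1 -> \bar R) (g : 'rV[R]_d2 -> \bar R)
  (* partial Lipschitz moduli *)
  (L1 : 'rV[R]_d2 -> R) (L2 : 'rV[R]_d1 -> R)
  (lam1m lam1p lam2m lam2p : R)
  (* estimator constants *)
  (V1 VU rho : R)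
  (* parameters *)
  (eps veps abar1 abar2 bbar1 bbar2 : R)
  (alpha1 alpha2 beta1 beta2 : nat -> R)
  (* probability space, iterates, estimator values, Upsilon *)
  (dsp : measure_display) (Omega : measurableType dsp) (P : probability Omega R)
  (x1 : nat -> Omega -> 'rV[R]_d1) (x2 : nat -> Omega -> 'rV[R]_d2)
  (a1 : 'rV[R]_d1) (a2 : 'rV[R]_d2)
  (G1 : nat -> Omega -> 'rV[R]_d1) (G2 : nat -> Omega -> 'rV[R]_d2)
  (Ups : nat -> Omega -> R) :
  let H := fun (u : 'rV[R]_d1) (v : 'rV[R]_d2) => n%:R^-1 * \sum_(i < n) h i u v in
  let gH1 := fun (u : 'rV[R]_d1) (v : 'rV[R]_d2) => n%:R^-1 *: \sum_(i < n) Dh1 i u v in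
  let gH2 := fun (u : 'rV[R]_d1) (v : 'rV[R]_d2) => n%:R^-1 *: \sum_(i < n) Dh2 i u v in
  let F := fun (u : 'rV[R]_d1) (v : 'rV[R]_d2) => ((H u v)%:E + f u + g v)%E in
  let S := 4 * ((rho * V1 + VU) / (rho * M)) + veps in
  let delta1 := ((M + lam1p) * abar1 + 2 * lam1p * bbar1 ^+ 2 + S) / (1 - 2 * abar1 - eps) in
  let delta2 := ((M + lam2p) * abar2 + 2 * lam2p * bbar2 ^+ 2 + S) / (1 - 2 * abar2 - eps) in
  let tau1 := fun k w => ((1 + eps) * delta1 + M + L1 (x2 k w) + S) / (1 - alpha1 k) in
  let tau2 := fun k w => ((1 + eps) * delta2 + M + L2 (x1 k.+1 w) + S) / (1 - alpha2 k) in
  (* extrapolated points; x^{-1} := x^0 is encoded by k.-1 (0.-1 = 0) *)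
  let y1 := fun k w => x1 k w + alpha1 k *: (x1 k w - x1 k.-1 w) in
  let z1 := fun k w => x1 k w + beta1 k *: (x1 k w - x1 k.-1 w) in
  let y2 := fun k w => x2 k w + alpha2 k *: (x2 k w - x2 k.-1 w) in
  let z2 := fun k w => x2 k w + beta2 k *: (x2 k w - x2 k.-1 w) in
  (* ||x^{k+1} - x^k||^2 and ||x^k-x^{k-1}||^2 + ||x^{k-1}-x^{k-2}||^2 *)
  let dnext := fun k w => pnorm2 (x1 k.+1 w - x1 k w) (x2 k.+1 w - x2 k w) in
  let dprev := fun k w => pnorm2 (x1 k w - x1 k.-1 w) (x2 k w - x2 k.-1 w)
                        + pnorm2 (x1 k.-1 w - x1 k.-2 w) (x2 k.-1 w - x2 k.-2 w) in
  (* ||u^{k+1} - u^k||^2 *)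
  let du := fun k w => dnext k w + dprev k w in
  let Fk := gen_sigma x1 x2 in
  (* --- standing assumptions on F --- *)
  (0 < n)%N ->
  0 < M ->
  (forall i, is_gradient (h i) (Dh1 i) (Dh2 i)) ->
  (forall i, lipschitz_gradient M (Dh1 i) (Dh2 i)) ->
  proper_fun f -> lsc f -> bounded_below f ->
  proper_fun g -> lsc g -> bounded_below g ->
  (exists m : R, forall u v, (m%:E <= F u v)%E) ->
  (forall v u u', enorm (gH1 u v - gH1 u' v) <= L1 v * enorm (u - u')) ->
  (forall u v v', enorm (gH2 u v - gH2 u v') <= L2 u * enorm (v - v')) ->
  0 < lam1m -> 0 < lam1p -> 0 < lam2m -> 0 < lam2p ->
  (forall k w, lam1m <= L1 (x2 k w) <= lam1p) ->
  (forall k w, lam2m <= L2 (x1 k w) <= lam2p) ->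
  (* --- random iterates --- *)
  (forall k (i : 'I_d1), measurable_fun setT (fun w => x1 k w 0 i)) ->
  (forall k (i : 'I_d2), measurable_fun setT (fun w => x2 k w 0 i)) ->
  (forall k (i : 'I_d1), measurable_fun setT (fun w => G1 k w 0 i)) ->
  (forall k (i : 'I_d2), measurable_fun setT (fun w => G2 k w 0 i)) ->
  (* --- iSPALM --- *)
  (forall w, x1 0 w = a1) -> (forall w, x2 0 w = a2) ->
  (forall k w, x1 k.+1 w \in prox (tau1 k w) f (y1 k w - (tau1 k w)^-1 *: G1 k w)) ->
  (forall k w, x2 k.+1 w \in prox (tau2 k w) g (y2 k w - (tau2 k w)^-1 *: G2 k w)) ->
  (* --- inertial variance-reduced estimator along the iterates --- *)
  0 <= V1 -> 0 <= VU -> 0 < rho <= 1 ->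
  (forall k w, 0 <= Ups k w) ->
  (forall k, measurable_fun setT (Ups k)) ->
  (Ex P (fun w => (Ups 1%N w)%:E) < +oo)%E ->
  (forall k, exists ZA ZB,
     is_cond_exp P (Fk k)
       (fun w => enorm (G1 k w - gH1 (z1 k w) (x2 k w)) ^+ 2
               + enorm (G2 k w - gH2 (x1 k.+1 w) (z2 k w)) ^+ 2) ZA /\
     is_cond_exp P (Fk k) (dnext k) ZB /\
     {ae P, forall w, ZA w <= Ups k w + V1 * (ZB w + dprev k w)}) ->
  (forall k, exists ZU ZB,
     is_cond_exp P (Fk k) (Ups k.+1) ZU /\
     is_cond_exp P (Fk k) (dnext k) ZB /\
     {ae P, forall w, ZU w <= (1 - rho) * Ups k w + VU * (ZB w + dprev k w)}) ->
  ((fun k => Ex P (fun w => (pnorm2 (x1 k w - x1 k.-1 w) (x2 k w - x2 k.-1 w))%:E))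
      @ \oo --> 0%E ->
   (fun k => Ex P (fun w => (Ups k w)%:E)) @ \oo --> 0%E) ->
  (* --- parameter conditions --- *)
  0 < eps -> 0 < veps ->
  0 < abar1 < (1 - eps) / 2 -> 0 < abar2 < (1 - eps) / 2 ->
  0 < bbar1 <= 1 -> 0 < bbar2 <= 1 ->
  (forall k, 0 <= alpha1 k <= abar1) -> (forall k, 0 <= alpha2 k <= abar2) ->
  (forall k, 0 <= beta1 k <= bbar1) -> (forall k, 0 <= beta2 k <= bbar2) ->
  (* --- conclusion --- *)
  let D2 := fun k w =>
    (dist0 (limiting_subdiff F (x1 k.+1 w) (x2 k.+1 w))
     * dist0 (limiting_subdiff F (x1 k.+1 w) (x2 k.+1 w)))%E in
  (exists C : R, 0 < C /\ forall k,
     (Ex P (D2 k) <= C%:E * Ex P (fun w => (du k w)%:E)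
                    + 3%:E * Ex P (fun w => (Ups k w)%:E))%E) /\
  (fun k => Ex P (D2 k)) @ \oo --> 0%E.
Proof.
move=> H gH1 gH2 F S delta1 delta2 tau1 tau2 y1 z1 y2 z2 dnext dprev du Fk n0 M0.
move=> hgrad hlip fP _ _ gP _ _ [m Fm] gHL1 gHL2 l1m0 l1p0 l2m0 l2p0 L1P L2P.
move=> mx1 mx2 mG1 mG2 x10 x20 prox1 prox2 V10 VU0 /andP[rho0 rho1] Ups0 mUps _.
move=> condA condB condU eps0 veps0 abar1P abar2P bbar1P bbar2P al1 al2 be1 be2 D2.
have gH : is_gradient H gH1 gH2 by exact: is_gradientZ (is_gradient_sum hgrad).
have gHM := lipschitz_gradient_mean n0 (ltW M0) hlip.
have S0 : 0 < S.
  rewrite ltr_wpDl// mulr_ge0// divr_ge0//.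
    by rewrite addr_ge0// mulr_ge0// ltW.
  by rewrite mulr_ge0// ltW.
(* By conversion [dnext k] is [pD k.+1] and [dprev k] is the sum of [pD k] and [pD k.-1]; since
   [0.-1 = 0], [pD 0] vanishes. *)
pose pD k w := pnorm2 (x1 k w - x1 k.-1 w) (x2 k w - x2 k.-1 w).
pose err k w := enorm (G1 k w - gH1 (z1 k w) (x2 k w)) ^+ 2
               + enorm (G2 k w - gH2 (x1 k.+1 w) (z2 k w)) ^+ 2.
have L1k k w : 0 < L1 (x2 k w) <= lam1p.
  by have /andP[a b] := L1P k w; rewrite b (lt_le_trans l1m0).
have L2k k w : 0 < L2 (x1 k w) <= lam2p.
  by have /andP[a b] := L2P k w; rewrite b (lt_le_trans l2m0).
have msub d (X Y : Omega -> 'rV[R]_d) (c : R) :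
    (forall i, measurable_fun setT (fun w => X w 0 i)) ->
    (forall i, measurable_fun setT (fun w => Y w 0 i)) ->
    forall i, measurable_fun setT (fun w => (X w + c *: Y w) 0 i).
  move=> mX mY i; under eq_fun do rewrite !mxE.
  by apply: measurable_funD => //; apply: measurable_funM.
have mopp d (X Y : Omega -> 'rV[R]_d) :
    (forall i, measurable_fun setT (fun w => X w 0 i)) ->
    (forall i, measurable_fun setT (fun w => Y w 0 i)) ->
    forall i, measurable_fun setT (fun w => (X w - Y w) 0 i).
  move=> mX mY i; under eq_fun do rewrite -scaleN1r.
  exact: (@msub).
have m_p k : measurable_fun setT (pD k).
  by apply: measurable_funD; apply: measurable_enorm2; exact: (@mopp).
have m_e k : measurable_fun setT (err k).
  (* Each coordinate of the gradients is Lipschitz, so it preserves measurability. *)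
  have mg1 (X1 : Omega -> 'rV[R]_d1) (X2 : Omega -> 'rV[R]_d2) :
      (forall i, measurable_fun setT (fun w => X1 w 0 i)) ->
      (forall i, measurable_fun setT (fun w => X2 w 0 i)) ->
      (forall i, measurable_fun setT (fun w => gH1 (X1 w) (X2 w) 0 i)) /\
      (forall i, measurable_fun setT (fun w => gH2 (X1 w) (X2 w) 0 i)).
    move=> mX1 mX2; split=> i.
      apply: (measurable_lipschitz_comp (phi := fun a b => gH1 a b 0 i)
        (sqr_ge0 M) mX1 mX2).
      move=> a b a' b'; apply: le_trans (gHM a' b' a b); rewrite pnorm2E.
      have := coord_sqr_le (gH1 a' b' - gH1 a b) i; rewrite !mxE => /le_trans; apply.
      by rewrite lerDl dotvv_ge0.
    apply: (measurable_lipschitz_comp (phi := fun a b => gH2 a b 0 i)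
        (sqr_ge0 M) mX1 mX2).
    move=> a b a' b'; apply: le_trans (gHM a' b' a b); rewrite pnorm2E.
    have := coord_sqr_le (gH2 a' b' - gH2 a b) i; rewrite !mxE => /le_trans; apply.
    by rewrite lerDr dotvv_ge0.
  apply: measurable_funD; apply: measurable_enorm2; apply: (@mopp) => //.
    apply: (mg1 (z1 k) (x2 k) _ _).1 => //.
    by apply: (@msub) => //; exact: (@mopp).
  apply: (mg1 (x1 k.+1) (z2 k) _ _).2 => //.
  by apply: (@msub) => //; exact: (@mopp).
have FkT k : Fk k setT by exact: gen_sigmaT.
(* Square integrability of increments and errors is extracted from the existence of their
   conditional expectations. *)
have p_e k : [/\ Rintegrable P (pD k.+1) & Rintegrable P (err k)].
  have [ZA [ZB [cA [cB _]]]] := condA k; split.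
    by have [] := cond_exp_mean (m_p k.+1) (FkT k) cB.
  by have [] := cond_exp_mean (m_e k) (FkT k) cA.
have i_e k : Rintegrable P (err k) by have [] := p_e k.
have i_p k : Rintegrable P (pD k).
  case: k => [|k]; last by have [] := p_e k.
  rewrite (_ : pD 0%N = fun=> 0); first exact: Rintegrable_cst.
  by apply/funext => w; rewrite /pD pnorm2E !subrr !dot0v addr0.
(* Integrability comes from the recursion, hence from index 1 on; [Ups 0] may have infinite mean. *)
have i_u k : Rintegrable P (Ups k.+1).
  have [ZU [ZB [cU _]]] := condB k.
  by have [] := cond_exp_mean (mUps k.+1) (FkT k) cU.
have i_dprev k : Rintegrable P (dprev k).
  exact: (RintegrableD (i_p k) (i_p k.-1)).
have E_dprev k : mean P (dprev k) = mean P (pD k) + mean P (pD k.-1).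
  exact: (meanD (i_p k) (i_p k.-1)).
have bound_e k : Rintegrable P (Ups k) ->
    mean P (err k) <= mean P (Ups k) + V1 * (mean P (pD k.+1) + mean P (dprev k)).
  move=> iU; have [ZA [ZB [cA [cB AB]]]] := condA k; rewrite -[mean P (Ups k)]mul1r.
  apply: cond_exp_bound (m_e k) (m_p k.+1) (FkT k)
    cA cB iU (i_dprev k) _.
  by apply: filterS AB => w; rewrite mul1r.
have bound_u k : mean P (Ups k.+2)
    <= (1 - rho) * mean P (Ups k.+1) + VU * (mean P (pD k.+2) + mean P (dprev k.+1)).
  have [ZU [ZB [cU [cB UB]]]] := condB k.+1.
  exact: cond_exp_bound (mUps k.+2) (m_p k.+2) (FkT k.+1)
    cU cB (i_u k) (i_dprev k.+1) UB.
pose T1 := 2 * ((1 + eps) * delta1 + M + lam1p + S).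
pose T2 := 2 * ((1 + eps) * delta2 + M + lam2p + S).
pose C0 := 12 * M ^+ 2 + 6 * T1 ^+ 2 + 6 * T2 ^+ 2.
have C00 : 0 < C0.
  have := sqr_ge0 T1; have := sqr_ge0 T2; have := exprn_gt0 2 M0.
  by rewrite /C0; lra.
have D2_ge0 k w : (0 <= D2 k w)%E by exact: dist0_sq_ge0.
have D2_le k w : (D2 k w <= (C0 * (pD k.+1 w + pD k w) + 3 * err k w)%:E)%E.
  exact: (dist_bound gH gHM fP gP M0 S0 eps0 l1p0 l2p0 abar1P abar2P bbar1P
    bbar2P (al1 k) (al2 k) (be1 k) (be2 k) (L1k k w) (L2k k.+1 w)
    (prox1 k w) (prox2 k w)).
have E_du k : (Ex P (fun w => (du k w)%:E)
    = (mean P (pD k.+1) + mean P (dprev k))%:E)%E.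
  rewrite -(meanD (i_p k.+1) (i_dprev k)) -EFin_mean//.
  exact: (RintegrableD (i_p k.+1) (i_dprev k)).
have p_ge0 k : 0 <= mean P (pD k) by apply: mean_ge0 => w; exact: pnorm2_ge0.
(* [3 * V1] comes from bounding the mean of [3 * err k] by [bound_e]. *)
clearbody C0; pose C := C0 + 3 * V1.
have C_gt0 : 0 < C by rewrite ltr_pwDl// mulr_ge0.
have E_D2 k : (Ex P (D2 k) <= C%:E * Ex P (fun w => (du k w)%:E)
                    + 3%:E * Ex P (fun w => (Ups k w)%:E))%E.
  have du0 : 0 <= mean P (pD k.+1) + mean P (dprev k) by rewrite E_dprev !addr_ge0.
  (* An infinite mean, possible only for [k = 0], makes the right side infinite. *)
  have [uoo|ufin] := eqVneq (Ex P (fun w => (Ups k w)%:E)) +oo%E.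
    by rewrite uoo gt0_muley ?lte_fin// E_du -EFinM addey ?leey.
  have iU : Rintegrable P (Ups k).
    apply/integrableP; split; first exact/measurable_EFinP.
    rewrite integral_fin_num_abs// ge0_fin_numE ?ltey//.
    by apply: integral_ge0 => w _; rewrite lee_fin.
  apply: (@le_trans _ _ (\int[P]_w (C0 * (pD k.+1 w + pD k w) + 3 * err k w)%:E)%E).
    (* Measurability of [D2 k] is not established, so monotonicity rests on nonnegativity alone. *)
    exact: integral_le_ge0 (D2_ge0 k) (D2_le k).
  have ipp := RintegrableD (i_p k.+1) (i_p k).
  have iA := RintegrableZ C0 ipp; have iB := RintegrableZ 3 (i_e k).
  rewrite E_du /Ex (EFin_mean iU) (EFin_mean (RintegrableD iA iB)).
  rewrite (meanD iA iB) (meanZ C0 ipp) (meanZ 3 (i_e k)).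
  rewrite (meanD (i_p k.+1) (i_p k)).
  rewrite -!EFinM -EFinD lee_fin E_dprev.
  have := bound_e k iU; rewrite E_dprev; exact: combine_le (ltW C00) (p_ge0 _).
split; first by exists C.
(* The index is shifted: [Phi k] is the potential at iterate [k.+1], where [f] and [g] are
   finite. *)
pose Phi k w := H (x1 k.+1 w) (x2 k.+1 w) + fine (f (x1 k.+1 w)) + fine (g (x2 k.+1 w))
  + (delta1 / 2 * dotv (x1 k.+1 w - x1 k w) (x1 k.+1 w - x1 k w)
     + delta2 / 2 * dotv (x2 k.+1 w - x2 k w) (x2 k.+1 w - x2 k w)).
have fx k w : f (x1 k.+1 w) \is a fin_num by exact: prox_fin_num fP _ _ _ (prox1 k w).
have gx k w : g (x2 k.+1 w) \is a fin_num by exact: prox_fin_num gP _ _ _ (prox2 k w).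
have Phi_step k w : Phi k.+1 w + S / 2 * (pD k.+2 w + pD k.+1 w)
    <= Phi k w + M^-1 * err k.+1 w.
  exact: (step_descent gH gHM fP gP gHL1 gHL2 M0 S0 eps0 l1p0 l2p0 abar1P abar2P
    (al1 k.+1) (al2 k.+1) (be1 k.+1) (be2 k.+1)
    (L1k k.+1 w) (L2k k.+2 w) (prox1 k.+1 w) (prox2 k.+1 w)).
have delta1_ge0 : 0 <= delta1 by apply: le_trans (ltW S0) _; exact: delta_ge.
have delta2_ge0 : 0 <= delta2 by apply: le_trans (ltW S0) _; exact: delta_ge.
have Phi_ge k w : m <= Phi k w.
  have := Fm (x1 k.+1 w) (x2 k.+1 w); rewrite /F -(fineK (fx k w)) -(fineK (gx k w)).
  rewrite -!EFinD lee_fin => /le_trans; apply.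
  by rewrite lerDl; apply: addr_ge0; apply: mulr_ge0 (dotvv_ge0 _); exact: divr_ge0.
have tel k w : Phi k w + S / 2 * \sum_(j < k) (pD j.+2 w + pD j.+1 w)
    <= Phi 0%N w + M^-1 * \sum_(j < k) err j.+1 w.
  elim: k => [|k IH]; first by rewrite !big_ord0 !mulr0.
  rewrite !big_ord_recr /=; have := Phi_step k w; move: IH; lra.
have [v1 fv1] := fP.2; have [v2 gv2] := gP.2.
have [K1 [c B1]] : exists K1 c, forall w,
    H (x1 1%N w) (x2 1%N w) + fine (f (x1 1%N w)) + fine (g (x2 1%N w))
    <= K1 + c * pD 1%N w + err 0%N w.
  (* The witnesses are fixed before [w]: [x10] and [x20] replace the initial iterates by [a1] and
     [a2], so that the constant is deterministic. *)
  eexists; eexists => w.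
  have := first_step_bound gH gHM fP gP M0 S0 eps0 l1p0 l2p0 abar1P abar2P
    (beta1 0%N) (beta2 0%N) (al1 0%N) (al2 0%N) (L1k 0%N w) (L2k 1%N w)
    (prox1 0%N w) (prox2 0%N w) erefl erefl fv1 gv2.
  rewrite -[enorm _ ^+ 2 + enorm _ ^+ 2]/(err 0%N w).
  rewrite -[pnorm2 _ _]/(pD 1%N w) x10 x20; exact.
have Phi0 w : Phi 0%N w <= K1 + (c + (delta1 / 2 + delta2 / 2)) * pD 1%N w + err 0%N w.
  have := lerD (B1 w) (@weighted_le _ (delta1 / 2) (delta2 / 2) _ _
    (divr_ge0 delta1_ge0 (ler0n _ 2)) (divr_ge0 delta2_ge0 (ler0n _ 2))
    (dotvv_ge0 (x1 1%N w - x1 0%N w)) (dotvv_ge0 (x2 1%N w - x2 0%N w))).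
  rewrite -pnorm2E -[pnorm2 _ _]/(pD 1%N w) => /le_trans; apply.
  by rewrite le_eqVlt; apply/orP; left; apply/eqP; ring.
set K2 := c + _ in Phi0.
(* Mean of the upper bound [Phi0] on the initial potential, minus the lower bound [m] on every later
   one. *)
pose B := K1 - m + K2 * mean P (pD 1%N) + mean P (err 0%N).
have hB N : S / 2 * \sum_(k < N) (mean P (pD k.+2) + mean P (pD k.+1))
    <= B + M^-1 * \sum_(k < N) mean P (err k.+1).
  have iDD k : Rintegrable P (fun w => pD k.+2 w + pD k.+1 w).
    exact: RintegrableD (i_p _) (i_p _).
  have iSD := Rintegrable_sum (fun k (_ : (k < N)%N) => iDD k).
  have iSe := Rintegrable_sum (fun k (_ : (k < N)%N) => i_e k.+1).
  have iK : Rintegrable P (fun w => K1 - m + K2 * pD 1%N w + err 0%N w).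
    apply: RintegrableD (i_e 0%N).
    exact: RintegrableD (Rintegrable_cst P (K1 - m)) (RintegrableZ K2 (i_p 1%N)).
  have : mean P (fun w => S / 2 * \sum_(k < N) (pD k.+2 w + pD k.+1 w))
      <= mean P (fun w => (K1 - m + K2 * pD 1%N w + err 0%N w)
                       + M^-1 * \sum_(k < N) err k.+1 w).
    apply: mean_le => [||w]; first exact: RintegrableZ.
      exact: RintegrableD iK (RintegrableZ _ iSe).
    have := tel N w; have := Phi_ge N w; have := Phi0 w.
    move: (S / 2 * _) (M^-1 * _) (Phi N w) (Phi 0%N w) (K2 * _) (err _ _) => *.
    lra.
  rewrite (meanZ _ iSD) (meanD iK (RintegrableZ _ iSe)) (meanZ _ iSe).
  rewrite (mean_sum (fun k (_ : (k < N)%N) => iDD k)).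
  rewrite (mean_sum (fun k (_ : (k < N)%N) => i_e k.+1)).
  have iK1 := Rintegrable_cst P (K1 - m); have iK2 := RintegrableZ K2 (i_p 1%N).
  rewrite (meanD (RintegrableD iK1 iK2) (i_e 0%N)) (meanD iK1 iK2).
  rewrite mean_cst (meanZ _ (i_p 1%N)).
  by under eq_bigr => k _ do rewrite (meanD (i_p k.+2) (i_p k.+1)).
have p_cvg : (fun k => mean P (pD k)) @ \oo --> 0.
  apply: (@increments_cvg0 _ _ (fun k => mean P (err k)) (fun k => mean P (Ups k)) V1 VU
    rho M S veps B) => // [k|k|k].
  - by apply: mean_ge0 => w; exact: Ups0.
  - by have := bound_e k.+1 (i_u k); rewrite E_dprev.
  - by have := bound_u k; rewrite E_dprev.
have u_cvg : (fun k => mean P (Ups k)) @ \oo --> 0.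
  apply: fine_cvg; apply: condU.
  rewrite (_ : (fun k => _) = fun k => (mean P (pD k))%:E); first exact: cvg_EFin_fun.
  by apply/funext => k; rewrite -EFin_mean.
(* Dropping the term of index 0 makes the bound real-valued, since [Ups k.+1] is integrable. *)
rewrite -cvg_shiftS.
pose b k := C * (mean P (pD k.+2) + (mean P (pD k.+1) + mean P (pD k)))
  + 3 * mean P (Ups k.+1).
pose bnd k := (b k)%:E.
have D2_bnd : \forall k \near \oo, (0 <= Ex P (D2 k.+1) <= bnd k)%E.
  apply: nearW => k; apply/andP; split.
    by apply: integral_ge0 => w _; exact: D2_ge0.
  have EU : Ex P (fun w => (Ups k.+1 w)%:E) = (mean P (Ups k.+1))%:E.
    exact: EFin_mean.
  by have := E_D2 k.+1; rewrite E_du E_dprev EU -!EFinM -EFinD.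
have p1 : (fun k => mean P (pD k.+1)) @ \oo --> 0.
  by rewrite (cvg_shiftS (fun k => mean P (pD k))).
have p2 : (fun k => mean P (pD k.+2)) @ \oo --> 0.
  by rewrite (cvg_shiftS (fun k => mean P (pD k.+1))).
have u1 : (fun k => mean P (Ups k.+1)) @ \oo --> 0.
  by rewrite (cvg_shiftS (fun k => mean P (Ups k))).
have bnd_cvg : bnd @ \oo --> 0%E.
  have : b @ \oo --> C * (0 + (0 + 0)) + 3 * 0.
    exact: (cvgD (cvgM (cvg_cst C) (cvgD p2 (cvgD p1 p_cvg)))
      (cvgM (cvg_cst (3 : R)) u1)).
  by rewrite !addr0 !mulr0 addr0; exact: cvg_EFin_fun.
exact: squeeze_cvge D2_bnd _ (cvg_cst _) bnd_cvg.
Qed.
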